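(* The problem $\{2\}$-CSP$(\mathbb{K}_4)$ is decidable in polynomial time.
   Context: $\mathbb{K}_4$ is the complete graph on vertex set $\{1,2,3,4\}$ (edges between all pairs of distinct vertices, no loops). For a finite graph $\mathbf{B}$ and nonempty $X \subseteq \{1,\ldots,|B|\}$, $X$-CSP$(\mathbf{B})$ takes as input a sentence $Q_1 x_1 \ldots Q_m x_m\, \psi$, with $\psi$ a conjunction of atoms $E(x_i,x_k)$ and each $Q_i$ equal to $\exists^{\geq j}$ for some $j\in X$, and asks whether it is true in $\mathbf{B}$; $\exists^{\geq j} x\,\phi$ means at least $j$ distinct elements $x$ satisfy $\phi$. Thus in $\{2\}$-CSP$(\mathbb{K}_4)$ every variable is quantified by $\exists^{\geq 2}$. *)

(* Defs.v *)
From HB Require Import structures.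
From mathcomp Require Import all_boot.

Set Implicit Arguments.
Unset Strict Implicit.
Unset Printing Implicit Defensive.


Inductive move := MoveL | MoveN | MoveR.

(* [Sigma] is the input alphabet. The tape alphabet is the disjoint union of
   [Sigma], of the further symbols [work] and of the blank [None]. There are
   [extra.+1] tapes, tape [ord0] being the one that carries the input. The
   argument of [delta q] is the family of scanned cells, its value gives the
   symbol written and the move made on each tape; the domain of [delta] is
   finite, so that [delta] is a finite table. States with [verdict q = Some b] are
   halting, accepting if [b] and rejecting otherwise. *)
Record machine (Sigma : finType) := Machine {
  extra : nat;
  work : finType;
  state : finType;
  start : state;
  verdict : state -> option bool;
  delta : state -> {ffun 'I_extra.+1 -> option (Sigma + work)%type} ->
          state * ('I_extra.+1 -> option (Sigma + work)%type * move)
}.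

Section Run.
Variables (Sigma : finType) (M : machine Sigma).

Definition cell : finType := option (Sigma + work M)%type.

(* [(l, r)] is the two-way infinite tape ... l_1 l_0 r_0 r_1 ..., padded with
   blanks on both sides, whose scanned cell is the one containing [r_0]. *)
Definition tape : Type := (seq cell * seq cell)%type.

Definition scanned (t : tape) : cell := head None t.2.

Definition write_move (t : tape) (am : cell * move) : tape :=
  let: (l, r) := t in
  let: (a, m) := am in
  match m with
  | MoveL => (behead l, head None l :: a :: behead r)
  | MoveN => (l, a :: behead r)
  | MoveR => (a :: l, behead r)
  end.

Definition config : Type := (state M * ('I_(extra M).+1 -> tape))%type.

Definition init (w : seq Sigma) : config :=
  (start M, fun i => if i == ord0 then ([::], [seq Some (inl a) | a <- w])
                     else ([::], [::])).

(* Halting configurations are fixed. *)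
Definition step (c : config) : config :=
  let: (q, ts) := c in
  if verdict q is Some _ then c else
  let: (q', act) := delta q [ffun i => scanned (ts i)] in
  (q', fun i => write_move (ts i) (act i)).

Definition answer_after (n : nat) (w : seq Sigma) : option bool :=
  verdict (iter n step (init w)).1.

End Run.

Definition polytime_decidable (Sigma : finType) (L : seq Sigma -> Prop) : Prop :=
  exists (M : machine Sigma) (c k : nat), forall w : seq Sigma,
  exists b : bool,
    answer_after M (c * size w ^ k + c) w = Some b /\ (b <-> L w).


(* [Sentence [:: j_0; ...; j_(m-1)] ats] is the sentence
   E^{>= j_0} x_0 ... E^{>= j_(m-1)} x_(m-1), psi, with psi the conjunction
   of the atoms E(x_i, x_k) for [(i, k)] in [ats]. *)
Record sentence := Sentence {
  quants : seq nat;
  atoms : seq (nat * nat)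
}.

(* The quantifiers are taken from [X] and all variables are bound. *)
Definition X_sentence (X : pred nat) (phi : sentence) : bool :=
  all X (quants phi) &&
  all (fun a => (a.1 < size (quants phi)) && (a.2 < size (quants phi)))
      (atoms phi).

Section Semantics.
Variables (T : finType) (E : rel T).

(* [env] lists the values of x_0, x_1, ... chosen so far. *)
Definition atom_true (env : seq T) (a : nat * nat) : bool :=
  match onth env a.1, onth env a.2 with
  | Some u, Some v => E u v
  | _, _ => false
  end.

Fixpoint eval (ats : seq (nat * nat)) (env : seq T) (qs : seq nat) : bool :=
  match qs with
  | [::] => all (atom_true env) ats
  | j :: qs' => j <= #|[set x : T | eval ats (rcons env x) qs']|
  end.

Definition sentence_true (phi : sentence) : bool :=
  eval (atoms phi) [::] (quants phi).

End Semantics.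


Inductive letter := LQuant | LEdge | LSep | LTick.

Definition ord_of_letter (a : letter) : 'I_4 :=
  match a with
  | LQuant => @Ordinal 4 0 isT
  | LEdge => @Ordinal 4 1 isT
  | LSep => @Ordinal 4 2 isT
  | LTick => @Ordinal 4 3 isT
  end.

Definition letter_of_ord (i : 'I_4) : letter :=
  nth LQuant [:: LQuant; LEdge; LSep; LTick] i.

Lemma ord_of_letterK : cancel ord_of_letter letter_of_ord.
Proof. by case. Qed.

HB.instance Definition _ := Finite.copy letter (can_type ord_of_letterK).

(* Numbers are written in unary. The prefix contains one [LQuant] for each
   variable and the indices in atoms are smaller than the number of variables,
   so this is at most quadratically longer than writing the indices in
   binary. *)
Definition encode_quant (j : nat) : seq letter := LQuant :: nseq j LTick.

Definition encode_atom (a : nat * nat) : seq letter :=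
  LEdge :: nseq a.1 LTick ++ LSep :: nseq a.2 LTick.

Definition encode (phi : sentence) : seq letter :=
  flatten (map encode_quant (quants phi)) ++
  flatten (map encode_atom (atoms phi)).

Lemma nseq_tick_inj (i j : nat) (s t : seq letter) :
  ohead s != Some LTick -> ohead t != Some LTick ->
  nseq i LTick ++ s = nseq j LTick ++ t -> i = j /\ s = t.
Proof.
elim: i j => [|i IH] [|j] //= Hs Ht.
- by move=> e; rewrite e in Hs.
- by move=> e; rewrite -e in Ht.
- by case=> /(IH _ Hs Ht) [-> ->].
Qed.

Lemma encode_inj : injective encode.
Proof.
have hA ats : ohead (flatten (map encode_atom ats)) != Some LTick by case: ats.
have hQ qs ats : ohead (flatten (map encode_quant qs) ++
                        flatten (map encode_atom ats)) != Some LTick.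
  by case: qs => //=; apply: hA.
have injA ats1 ats2 : flatten (map encode_atom ats1) =
    flatten (map encode_atom ats2) -> ats1 = ats2.
  elim: ats1 ats2 => [|[i k] ats1 IH] [|[i' k'] ats2] //=.
  rewrite -!catA /=; case=> /nseq_tick_inj[] // -> [].
  by case/nseq_tick_inj => // -> /IH ->.
case=> [qs1 ats1] [qs2 ats2]; rewrite /encode /=.
elim: qs1 qs2 => [|j qs1 IH] [|j' qs2] /=.
- by move/injA => ->.
- by case: ats1.
- by case: ats2 {IH}.
- rewrite -!catA; case=> /nseq_tick_inj[] // -> /IH.
  by case=> -> ->.
Qed.


(* Words that do not encode an instance are not in the language. *)
Definition X_CSP (X : pred nat) (T : finType) (E : rel T) : seq letter -> Prop :=
  fun w => exists phi : sentence,
    [/\ X_sentence X phi, w = encode phi & sentence_true E phi].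

Definition K (n : nat) : rel 'I_n := fun u v => u != v.
Arguments K n _ _ : clear implicits.

(* Main.v *)
(* In the game behind the sentence Prover offers two colours for each variable
   and Opponent picks one of them, and Prover wins if the final colouring is
   proper. Whatever Prover does, Opponent can make any two given variables
   differ. Hence the colours of the earlier neighbours of a variable are
   constrained, and these constraints can always be put in one of three forms:
   two variables get different colours, three variables get at most two colours,
   or z avoids the colours of x and y whenever those differ. The constraints
   are propagated from the last variable to the first; Prover wins if and only
   if the closure contains no contradiction. This closure is the least model of
   a Datalog program over the positions of the input word, and so are the
   parsing of the input and its check. Such a program runs in polynomial time
   since there are only polynomially many facts. *)

From HB Require Import structures.
Require Import Defs.
From mathcomp Require Import all_boot zify.

Set Implicit Arguments.
Unset Strict Implicit.
Unset Printing Implicit Defensive.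

(** * Structured programs for multitape machines *)

(** What makes three forms enough is that four colours minus two are again two. If x and y have
    different colours, the second form leaves for z exactly the colours of x and y, and the third
    exactly the other two. So either one, once active, fixes the whole pair that Prover must offer,
    and two neighbours of z with different colours have the effect of the third form.

    The obstacle is that two such constraints on z compare two pairs of earlier variables: if both
    pairs are bichromatic, their colour sets are equal, or disjoint. This is a conditional relation
    on four variables. Opponent removes one condition: branching at the later of the two top
    variables makes its pair bichromatic and leaves the other three colours alone. What remains has
    three variables again; pairs with a common top variable are treated apart.

    The program enters only through the existence of a model without goal facts. If the sentence is
    true, the constraints valid in all plays made of winning moves form such a model, so no strategy
    has to be described. Conversely any such model, least or not, gives Prover an invariant to play
    by. *)

Section Components.
Variables (A : finType) (K : nat).

Definition tapes := 'I_K -> seq (option A) * seq (option A).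

Definition scan (ts : tapes) : {ffun 'I_K -> option A} :=
  [ffun i => head None (ts i).2].

Definition put_move (t : seq (option A) * seq (option A))
    (am : option A * move) : seq (option A) * seq (option A) :=
  let: (l, r) := t in
  let: (a, m) := am in
  match m with
  | MoveL => (behead l, head None l :: a :: behead r)
  | MoveN => (l, a :: behead r)
  | MoveR => (a :: l, behead r)
  end.

Definition act (f : 'I_K -> option A * move) (ts : tapes) : tapes :=
  fun i => put_move (ts i) (f i).

Definition stay (c : {ffun 'I_K -> option A}) (i : 'I_K) := (c i, MoveN).

(* The next state [None] means that control leaves the component. *)
Record comp := Comp {
  cstate : finType;
  cstart : cstate;
  cstep : cstate -> {ffun 'I_K -> option A} ->
          option cstate * ('I_K -> option A * move)
}.

Inductive run (C : comp) : cstate C -> tapes -> nat -> tapes -> Prop :=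
| run_exit s ts f : cstep s (scan ts) = (None, f) -> run s ts 1 (act f ts)
| run_step s s' ts f t ts' : cstep s (scan ts) = (Some s', f) ->
    run s' (act f ts) t ts' -> run s ts t.+1 ts'.

(** A Hoare triple for total correctness, with a bound on the number of steps. *)
Definition triple (P : tapes -> Prop) (C : comp) (T : nat) (Q : tapes -> Prop) :=
  forall ts, P ts -> exists t ts',
    [/\ t <= T, run (cstart C) ts t ts' & Q ts'].

Lemma triple_conseq P P' C T T' Q Q' :
  (forall ts, P' ts -> P ts) -> T <= T' -> (forall ts, Q ts -> Q' ts) ->
  triple P C T Q -> triple P' C T' Q'.
Proof.
move=> hP hT hQ h ts /hP /h[t [ts' [ht hr /hQ hq]]].
by exists t, ts'; split=> //; apply: leq_trans hT.
Qed.

Definition actC (f : {ffun 'I_K -> option A} -> 'I_K -> option A * move) :=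
  @Comp unit tt (fun _ c => (None, f c)).

Lemma triple_act f (P Q : tapes -> Prop) :
  (forall ts, P ts -> Q (act (f (scan ts)) ts)) -> triple P (actC f) 1 Q.
Proof.
move=> h ts /h hQ; exists 1, (act (f (scan ts)) ts).
by split=> //; apply: run_exit.
Qed.

(** The transition that leaves [C1] enters the start state of [C2] directly, so running times simply
    add up. *)
Definition seqC (C1 C2 : comp) :=
  @Comp (cstate C1 + cstate C2)%type (inl (cstart C1)) (fun s c =>
    match s with
    | inl s1 => let: (s', f) := cstep s1 c in
        (Some (if s' is Some s1' then inl s1' else inr (cstart C2)), f)
    | inr s2 => let: (s', f) := cstep s2 c in (omap inr s', f)
    end).

Lemma triple_seq P Q R C1 C2 T1 T2 :
  triple P C1 T1 Q -> triple Q C2 T2 R -> triple P (seqC C1 C2) (T1 + T2) R.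
Proof.
move=> h1 h2 ts /h1[t1 [ts1 [ht1 r1 /h2[t2 [ts2 [ht2 r2 hR]]]]]].
exists (t1 + t2), ts2; split=> //; first exact: leq_add.
have {}r2 : @run (seqC C1 C2) (inr (cstart C2)) ts1 t2 ts2.
  elim: r2 => [s ts3 f e|s s' ts3 f t ts4 e _ IH].
    by apply: run_exit; rewrite /= e.
  by apply: run_step IH; rewrite /= e.
rewrite /=; elim: r1 r2 => [s ts3 f e|s s' ts3 f t ts4 e _ IH] r2.
  by apply: run_step r2; rewrite /= e.
by rewrite addSn; apply: run_step (IH r2); rewrite /= e.
Qed.

Definition whileC (b : {ffun 'I_K -> option A} -> bool) (C : comp) :=
  @Comp (option (cstate C)) None (fun s c =>
    match s with
    | None => (if b c then Some (Some (cstart C)) else None, stay c)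
    | Some s => let: (s', f) := cstep s c in (Some s', f)
    end).

(** The test of a loop rewrites every scanned cell with its own content. This can turn an exhausted
    half tape [[::]] into [[:: None]], so assertions have to survive such a step. *)
Definition stable (P : tapes -> Prop) :=
  forall ts, P ts -> P (act (stay (scan ts)) ts).

(** Indexing the invariant by the number of finished rounds fixes the number of rounds in advance,
    so no separate variant is needed. Each round pays one step for its test, and one more step
    leaves the loop. *)
Lemma triple_while (P : nat -> tapes -> Prop)
    (b : {ffun 'I_K -> option A} -> bool) C T N :
  (forall k, stable (P k)) ->
  (forall k ts, k < N -> P k ts -> b (scan ts)) ->
  (forall ts, P N ts -> b (scan ts) = false) ->
  (forall k, k < N -> triple (P k) C T (P k.+1)) ->
  triple (P 0) (whileC b C) (N * T.+1).+1 (P N).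
Proof.
move=> st ht hf hb.
suff h d k : k + d = N -> triple (P k) (whileC b C) (d * T.+1).+1 (P N).
  exact: h.
elim: d k => [|d IH] k e ts hP.
  rewrite addn0 in e; subst k.
  exists 1, (act (stay (scan ts)) ts); split=> //; last exact: st.
  by apply: run_exit; rewrite /= (hf _ hP).
have kN : k < N by lia.
have [t1 [ts1 [ht1 r1 hP1]]] := hb k kN _ (st _ _ hP).
have [t2 [ts2 [ht2 r2 hP2]]] := IH k.+1 (etrans (addSnnS _ _) e) _ hP1.
exists (t1 + t2).+1, ts2; split=> //; first by rewrite mulSn; lia.
have e1 : @cstep (whileC b C) None (scan ts)
    = (Some (Some (cstart C)), stay (scan ts)) by rewrite /= (ht _ _ kN hP).
apply: run_step e1 _.
elim: r1 r2 => [s ts3 f es|s s' ts3 f t ts4 es _ IHr] r2.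
  by apply: run_step r2; rewrite /= es.
by rewrite addSn; apply: run_step (IHr r2); rewrite /= es.
Qed.

(* [f] is the content of a tape whose cells to the left of cell 0 are blank,
   and [p] is the position of the head. *)
Definition holds (t : seq (option A) * seq (option A))
    (f : nat -> option A) (p : nat) :=
  (forall i, nth None t.2 i = f (p + i)) /\
  (forall i, nth None t.1 i = if i < p then f (p - i.+1) else None).

Definition move_pos (m : move) (p : nat) :=
  match m with MoveL => p.-1 | MoveN => p | MoveR => p.+1 end.

Lemma holds_scan t f p : holds t f p -> head None t.2 = f p.
Proof. by case=> h _; rewrite -nth0 h addn0. Qed.

Lemma holds_move t f g p a m :
  holds t f p -> (m = MoveL -> 0 < p) -> g p = a ->
  (forall q, q != p -> g q = f q) ->
  holds (put_move t (a, m)) g (move_pos m p).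
Proof.
case: t => l r [/= hr hl] hp gp gq.
have hr' i : nth None (behead r) i = g (p.+1 + i).
  by rewrite nth_behead hr addSnnS gq //; lia.
have lt_l i : i < p -> g (p - i.+1) = f (p - i.+1) by move=> ip; apply: gq; lia.
case: m hp => hp /=; split.
- have {}hp := hp erefl.
  case=> [|[|i]] /=; first by rewrite addn0 -nth0 hl hp -lt_l // subn1.
    by rewrite -gp; congr g; lia.
  by rewrite hr'; congr g; lia.
- have {}hp := hp erefl => i.
  rewrite nth_behead hl; have -> : (i < p.-1) = (i.+1 < p) by lia.
  by case: ifP => // ip; rewrite -lt_l //; congr g; lia.
- by case=> [|i] /=; [rewrite addn0 | rewrite hr'; congr g; lia].
- by move=> i; rewrite hl; case: ifP => // ip; rewrite lt_l.
- by [].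
- case=> [|i] /=; first by rewrite -gp; congr g; lia.
  by rewrite hl ltnS subSS; case: ifP => // ip; rewrite lt_l.
Qed.

Lemma holds_stay t f p :
  holds t f p -> holds (put_move t (head None t.2, MoveN)) f p.
Proof.
by move=> h; apply: (@holds_move t f f p _ MoveN) => //; rewrite (holds_scan h).
Qed.

End Components.

(** * Nested loops over the input in polynomial time *)

Section Poly.

Definition poly_bounded (T : nat -> nat) :=
  exists C k, forall n, T n <= C * n.+1 ^ k.

Lemma poly_bounded_const c : poly_bounded (fun _ => c).
Proof. by exists c, 0 => n; rewrite expn0 muln1. Qed.

Lemma poly_bounded_id : poly_bounded id.
Proof. by exists 1, 1 => n; rewrite mul1n expn1. Qed.

Lemma poly_bounded_add T1 T2 : poly_bounded T1 -> poly_bounded T2 ->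
  poly_bounded (fun n => T1 n + T2 n).
Proof.
move=> [C1 [k1 h1]] [C2 [k2 h2]]; exists (C1 + C2), (k1 + k2) => n.
rewrite mulnDl; apply: leq_add.
  apply: leq_trans (h1 n) _; by rewrite leq_mul2l leq_pexp2l ?leq_addr ?orbT.
apply: leq_trans (h2 n) _; by rewrite leq_mul2l leq_pexp2l ?leq_addl ?orbT.
Qed.

Lemma poly_bounded_mul T1 T2 : poly_bounded T1 -> poly_bounded T2 ->
  poly_bounded (fun n => T1 n * T2 n).
Proof.
move=> [C1 [k1 h1]] [C2 [k2 h2]]; exists (C1 * C2), (k1 + k2) => n.
by rewrite expnD mulnACA; apply: leq_mul.
Qed.

Lemma poly_bounded_S T : poly_bounded T -> poly_bounded (fun n => (T n).+1).
Proof.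
move=> h; have [C [k hC]] := poly_bounded_add h (poly_bounded_const 1).
by exists C, k => n; rewrite -addn1.
Qed.

End Poly.

Section Loops.
Variables (Sigma S G : finType) (s0 : S) (D : nat).

Inductive cmd :=
| Skip
| Op (i j k : nat) (g : Sigma -> G -> S -> G * S)
| Seq (c1 c2 : cmd)
| Loop (c : cmd).

Definition store := (nat -> nat -> nat -> S)%type.

Definition upd_store (m : store) x y z s : store :=
  fun x' y' z' => if (x' == x) && (y' == y) && (z' == z) then s else m x' y' z'.

(* [env] lists the values of the variables of the enclosing loops, the
   outermost first; each loop runs over the positions of [w]. *)
Fixpoint exec (w : seq Sigma) (c : cmd) (env : seq nat) (mf : store * G) :
    store * G :=
  match c with
  | Skip => mf
  | Op i j k g =>
      let x := nth 0 env i in let y := nth 0 env j in let z := nth 0 env k in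
      if onth w x is Some a then
        let: (f', s) := g a mf.2 (mf.1 x y z) in (upd_store mf.1 x y z s, f')
      else mf
  | Seq c1 c2 => exec w c2 env (exec w c1 env mf)
  | Loop c => foldl (fun mf x => exec w c (rcons env x) mf) mf (iota 0 (size w))
  end.

Fixpoint fits (d : nat) (c : cmd) : bool :=
  match c with
  | Skip => true
  | Op i j k _ => [&& i < d, j < d & k < d]
  | Seq c1 c2 => fits d c1 && fits d c2
  | Loop c => (d < D) && fits d.+1 c
  end.

(* Tapes 0, ..., L - 1 all carry the input, shifted by one cell to the right,
   and the value of a loop variable is the position of the head, minus 1, on
   its tape; the last three of them are scratch. Tape L carries the store,
   with a mark in cell 0, and tape L + 1 the flag. *)
Local Notation L := (D + 3).
Local Notation K := (D + 3).+2.

Definition symb : finType := (Sigma + option (S + G))%type.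

Definition mark : option symb := Some (inr None).
Definition store_cell (s : S) : option symb := Some (inr (Some (inl s))).
Definition flag_cell (f : G) : option symb := Some (inr (Some (inr f))).

Definition input_cell (w : seq Sigma) (p : nat) : option symb :=
  if p is q.+1 then omap inl (onth w q) else None.

Definition content w (mc : nat -> option S) (f : G) (i p : nat) : option symb :=
  if i < L then input_cell w p
  else if i == L then (if p is _.+1 then obind store_cell (mc p) else mark)
  else if p is _.+1 then None else flag_cell f.

Definition rep w pos mc f (ts : tapes symb K) :=
  forall i : 'I_K, holds (ts i) (content w mc f i) (pos (i : nat)).

Lemma rep_ext w pos pos' mc f ts : pos =1 pos' ->
  rep w pos mc f ts -> rep w pos' mc f ts.
Proof. by move=> e h i; rewrite -e. Qed.

Lemma rep_stable w pos mc f : stable (rep w pos mc f).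
Proof. by move=> ts h i; rewrite /act /stay ffunE; apply: holds_stay. Qed.

Lemma rep_scan w pos mc f ts (i : 'I_K) : rep w pos mc f ts ->
  scan ts i = content w mc f i (pos i).
Proof. by move=> h; rewrite ffunE (holds_scan (h i)). Qed.

Definition moveC (ds : nat -> move) : comp symb K :=
  actC (fun c i => (c i, ds i)).

Lemma triple_move ds w pos pos' mc f :
  (forall i, move_pos (ds i) (pos i) = pos' i) ->
  (forall i, ds i = MoveL -> 0 < pos i) ->
  triple (rep w pos mc f) (moveC ds) 1 (rep w pos' mc f).
Proof.
move=> e hp; apply: triple_act => ts h i; rewrite /act ffunE -e.
by apply: (holds_move (h i)) => [/hp|/=|]; rewrite ?ffunE ?(holds_scan (h i)).
Qed.

Definition on1 i d : nat -> move := fun j => if j == i then d else MoveN.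
Definition on2 i d i' d' : nat -> move :=
  fun j => if j == i then d else if j == i' then d' else MoveN.

Definition set_pos (pos : nat -> nat) i p : nat -> nat :=
  fun j => if j == i then p else pos j.

Definition is_letter (i : nat) (c : {ffun 'I_K -> option symb}) : bool :=
  if c (inord i) is Some (inl _) then true else false.

Lemma rep_letter i w pos mc f ts : i < L -> rep w pos mc f ts ->
  is_letter i (scan ts) = (0 < pos i <= size w).
Proof.
move=> iL h; rewrite /is_letter (rep_scan _ h) inordK; last by lia.
rewrite /content iL; case: (pos i) => //= p; rewrite -onthTE.
by case: onth.
Qed.

Definition rewindC i : comp symb K :=
  seqC (moveC (on1 i MoveL))
    (seqC (whileC (is_letter i) (moveC (on1 i MoveL))) (moveC (on1 i MoveR))).

Ltac posx := let j := fresh "j" in move=> j; rewrite /on1 /on2 /set_pos;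
  repeat case: eqP => //=; intros; subst; lia.

Ltac posv := rewrite /on1 /on2 /set_pos;
  repeat (case: eqP => //=); intros; subst; lia.

Lemma triple_rewind i w pos pos' mc f : i < L -> 0 < pos i <= (size w).+1 ->
  (forall j, set_pos pos i 1 j = pos' j) ->
  triple (rep w pos mc f) (rewindC i) (size w * 2 + 3) (rep w pos' mc f).
Proof.
move=> iL hp epos; pose p := (pos i).-1.
pose P k := rep w (set_pos pos i (p - k)) mc f.
have h1 : triple (rep w pos mc f) (moveC (on1 i MoveL)) 1 (P 0).
  apply: triple_move; first by posx.
  by move=> j; rewrite /on1; case: eqP => // -> _; lia.
have h2 : triple (P 0) (whileC (is_letter i) (moveC (on1 i MoveL))) (p * 2).+1
    (P p).
  apply: triple_while => [k|k ts kp hP|ts hP|k kp]; first exact: rep_stable.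
  - by rewrite (rep_letter iL hP) /set_pos eqxx; lia.
  - by rewrite (rep_letter iL hP) /set_pos eqxx; lia.
  apply: triple_move; first by posx.
  by move=> j; rewrite /on1 /set_pos; case: eqP => // _ _; lia.
have h3 : triple (P p) (moveC (on1 i MoveR)) 1 (rep w pos' mc f).
  apply: triple_move; first by move=> j; rewrite -epos; move: j; posx.
  by move=> j; rewrite /on1; case: eqP.
apply: (triple_conseq _ _ _ (triple_seq h1 (triple_seq h2 h3))) => //.
by lia.
Qed.

Definition forC i (body : comp symb K) : comp symb K :=
  seqC (whileC (is_letter i) (seqC body (moveC (on1 i MoveR)))) (rewindC i).

Lemma triple_for i w body T (P : nat -> tapes symb K -> Prop)
    (R : tapes symb K -> Prop) : i < L ->
  (forall k, stable (P k)) ->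
  (forall k ts, P k ts -> exists pos mc f, rep w pos mc f ts /\ pos i = k.+1) ->
  (forall k, k < size w ->
     triple (P k) (seqC body (moveC (on1 i MoveR))) T (P k.+1)) ->
  triple (P (size w)) (rewindC i) (size w * 2 + 3) R ->
  triple (P 0) (forC i body) ((size w * T.+1).+1 + (size w * 2 + 3)) R.
Proof.
move=> iL st hP hb hr; apply: triple_seq hr; apply: triple_while => //.
  move=> k ts kn /hP[pos [mc [f [h e]]]].
  by rewrite (rep_letter iL h) e.
move=> ts /hP[pos [mc [f [h e]]]].
by rewrite (rep_letter iL h) e ltnn.
Qed.

(** The tapes from [s] on must stand at the first letter because they are the counters that [body]
    may use; nesting therefore takes the next tape at each level. *)
Definition advances w s (body : comp symb K) T q := forall pos mc f,
  (forall j, s <= j < L -> pos j = 1) ->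
  triple (rep w pos mc f) body T (rep w (set_pos pos L (pos L + q)) mc f).

Lemma advances_move w s : advances w s (moveC (on1 L MoveR)) 1 1.
Proof.
move=> pos mc f _; apply: triple_move; first by posx.
by move=> j; rewrite /on1; case: eqP.
Qed.

Definition for_time n T := (n * T.+2).+1 + (n * 2 + 3).

Lemma advances_for w s body T q : s < L -> advances w s.+1 body T q ->
  advances w s (forC s body) (for_time (size w) T) (size w * q).
Proof.
move=> sL hb pos mc f hs.
have hs1 : pos s = 1 by apply: hs; lia.
pose P k := rep w (set_pos (set_pos pos s k.+1) L (pos L + k * q)) mc f.
have h := @triple_for s w body T.+1 P
  (rep w (set_pos pos L (pos L + size w * q)) mc f) sL.
apply: (triple_conseq _ _ _ (h _ _ _ _)) => [ts||ts|k|k ts hP|k kn|] //.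
- by apply: rep_ext; posx.
- exact: rep_stable.
- do 3 eexists; split; first exact: hP.
  by rewrite /set_pos eqxx; case: eqP => //; lia.
- rewrite -[T.+1]addn1; apply: triple_seq.
    apply: (hb (set_pos (set_pos pos s k.+1) L (pos L + k * q))) => j hj.
    rewrite /set_pos; case: eqP => [|_]; first by lia.
    by case: eqP => [|_]; [lia|apply: hs; lia].
  apply: triple_move; first by posx.
  by move=> j; rewrite /on1; case: eqP.
- apply: triple_rewind => //; last by posx.
  by rewrite /set_pos eqxx; case: eqP => //; lia.
Qed.

(* The value of variable [i] is kept on the scratch tape [s] during the
   repetition, and restored afterwards. *)
Definition timesC i s (body : comp symb K) : comp symb K :=
  seqC (moveC (on1 i MoveL))
  (seqC (whileC (is_letter i) (seqC body (moveC (on2 i MoveL s MoveR))))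
  (seqC (moveC (on2 i MoveR s MoveL))
  (seqC (whileC (is_letter s) (moveC (on2 s MoveL i MoveR)))
        (moveC (on1 s MoveR))))).

Definition times_time n T := n * T.+2 + n * 2 + 5.

Lemma triple_times w i s body T q pos mc f x : i < s -> s < L ->
  advances w s.+1 body T q -> pos i = x.+1 -> x <= size w ->
  (forall j, s <= j < L -> pos j = 1) ->
  triple (rep w pos mc f) (timesC i s body) (times_time (size w) T)
         (rep w (set_pos pos L (pos L + x * q)) mc f).
Proof.
move=> ltis sL hb px xn hs.
have hs1 : pos s = 1 by apply: hs; lia.
(* [P] describes the countdown of tape [i] against tape [s], and [P'] the way back. The blank in
   cell 0 stops each of the two loops, which is why one head is first moved one cell to the left. *)
pose P k := rep w (set_pos (set_pos (set_pos pos i (x - k)) s k.+1)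
                     L (pos L + k * q)) mc f.
pose P' k := rep w (set_pos (set_pos (set_pos pos i k.+1) s (x - k))
                     L (pos L + x * q)) mc f.
have h1 : triple (rep w pos mc f) (moveC (on1 i MoveL)) 1 (P 0).
  apply: triple_move; first by posx.
  by move=> j; rewrite /on1; case: eqP => // -> _; lia.
have iL : i < L by lia.
have h2 : triple (P 0)
    (whileC (is_letter i) (seqC body (moveC (on2 i MoveL s MoveR))))
    (x * T.+2).+1 (P x).
  apply: triple_while => [k|k ts kp hP|ts hP|k kp]; first exact: rep_stable.
  - by rewrite (rep_letter iL hP); posv.
  - by rewrite (rep_letter iL hP); posv.
  rewrite -[T.+1]addn1; apply: triple_seq.
    apply: (hb (set_pos (set_pos (set_pos pos i (x - k)) s k.+1)
                     L (pos L + k * q))) => j hj.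
    rewrite /set_pos; do 3 (case: eqP => [|_]; first by lia).
    by apply: hs; lia.
  apply: triple_move; first by posx.
  move=> j; rewrite /on2 /set_pos.
  by case: eqP => [->|_]; [do 2 case: eqP => [|_]; lia|case: eqP].
have h3 : triple (P x) (moveC (on2 i MoveR s MoveL)) 1 (P' 0).
  apply: triple_move; first by posx.
  move=> j; rewrite /on2 /set_pos.
  case: eqP => // _; case: eqP => [->|_ //].
  by case: eqP => //; lia.
have h4 : triple (P' 0) (whileC (is_letter s) (moveC (on2 s MoveL i MoveR)))
    (x * 2).+1 (P' x).
  apply: triple_while => [k|k ts kp hP|ts hP|k kp]; first exact: rep_stable.
  - by rewrite (rep_letter sL hP); posv.
  - by rewrite (rep_letter sL hP); posv.
  apply: triple_move; first by posx.
  move=> j; rewrite /on2 /set_pos.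
  case: eqP => [->|_]; [by case: eqP => [|_]; lia|by case: eqP].
have h5 : triple (P' x) (moveC (on1 s MoveR)) 1
    (rep w (set_pos pos L (pos L + x * q)) mc f).
  apply: triple_move; first by posx.
  by move=> j; rewrite /on1; case: eqP.
apply: (triple_conseq _ _ _ (triple_seq h1 (triple_seq h2 (triple_seq h3
  (triple_seq h4 h5))))) => //.
by rewrite /times_time; nia.
Qed.

(** The coordinates are digits in base [n]; the successor skips the mark in cell 0. *)
Definition address n x y z := (x * (n * n) + y * n + z).+1.

(** The address is never computed: the head makes one step past the mark, then [x] rounds of [n * n]
    unit moves, [y] rounds of [n] and finally [z] moves. *)
Definition gotoC i j k : comp symb K :=
  seqC (moveC (on1 L MoveR))
  (seqC (timesC i D (forC D.+1 (forC D.+2 (moveC (on1 L MoveR)))))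
  (seqC (timesC j D (forC D.+1 (moveC (on1 L MoveR))))
        (timesC k D (moveC (on1 L MoveR))))).

Definition goto_time n :=
  1 + (times_time n (for_time n (for_time n 1)) +
       (times_time n (for_time n 1) + times_time n 1)).

(** Tapes of variables not in scope, and the scratch tapes, get the default value 0, that is,
    position 1 on the first letter: exactly where a loop expects its head. *)
Definition pos_of (env : seq nat) (i : nat) :=
  if i < L then (nth 0 env i).+1 else 0.

Lemma triple_goto w env i j k mc f :
  all (gtn (size w)) env -> size env <= D ->
  [&& i < size env, j < size env & k < size env] ->
  let x := nth 0 env i in let y := nth 0 env j in let z := nth 0 env k in
  triple (rep w (pos_of env) mc f) (gotoC i j k) (goto_time (size w))
         (rep w (set_pos (pos_of env) L (address (size w) x y z)) mc f).
Proof.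
move=> /(all_nthP 0) hw hD /and3P[hi hj hk] x y z; set n := size w.
have [xn yn zn] : [/\ x <= n, y <= n & z <= n].
  by split; apply: ltnW; apply: hw.
have hpos v i' : i' < size env -> set_pos (pos_of env) L v i' = (nth 0 env i').+1.
  by move=> hi'; rewrite /set_pos /pos_of; case: eqP => [|_]; [lia|case: ifP; lia].
have hscr v s : D <= s < L -> set_pos (pos_of env) L v s = 1.
  move=> hs; rewrite /set_pos /pos_of; case: eqP => [|_]; first by lia.
  by case: ifP => [_|]; [rewrite nth_default //; lia|lia].
have hset v v' :
    set_pos (set_pos (pos_of env) L v) L v' =1 set_pos (pos_of env) L v'.
  by move=> l; rewrite /set_pos; case: eqP.
have atL v : set_pos (pos_of env) L v L = v by rewrite /set_pos eqxx.
pose P v := rep w (set_pos (pos_of env) L v) mc f.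
have body v q s T i' : D = s -> i' < size env -> advances w s.+1 q T v ->
    forall u, triple (P u) (timesC i' s q) (times_time n T)
      (P (u + nth 0 env i' * v)).
  move=> eD hi' had u.
  have h := @triple_times w i' s q T v (set_pos (pos_of env) L u) mc f
    (nth 0 env i').
  apply: (triple_conseq _ _ _ (h _ _ _ _ _ _)) => //; last 1 first.
  - by move=> l; rewrite -eD => ?; apply: hscr; lia.
  - by move=> ts; apply: rep_ext => l; rewrite atL hset.
  - by lia.
  - by lia.
  - exact: hpos.
  - by apply: ltnW; apply: hw.
have h0 : triple (rep w (pos_of env) mc f) (moveC (on1 L MoveR)) 1 (P 1).
  apply: triple_move; last by move=> l; rewrite /on1; case: eqP.
  move=> l; rewrite /on1 /set_pos; case: eqP => [->|//].
  by rewrite /= /pos_of ltnn.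
have [sL1 sL2] : D.+1 < L /\ D.+2 < L by lia.
have a1 s := @advances_move w s.
have a2 : advances w D.+1 (forC D.+1 (moveC (on1 L MoveR))) _ _ :=
  advances_for sL1 (a1 _).
have a3 : advances w D.+1 (forC D.+1 (forC D.+2 (moveC (on1 L MoveR)))) _ _ :=
  advances_for sL1 (advances_for sL2 (a1 _)).
have h1 := body _ _ _ _ _ erefl hi a3 1.
have h2 := body _ _ _ _ _ erefl hj a2 (1 + x * (n * (n * 1))).
have h3 := body _ _ _ _ _ erefl hk (a1 _) (1 + x * (n * (n * 1)) + y * (n * 1)).
have := triple_seq h0 (triple_seq h1 (triple_seq h2 h3)).
apply: triple_conseq => //.
move=> ts; apply: rep_ext => l; rewrite /address /z -/n; congr set_pos; lia.
Qed.

Lemma poly_for_time T : poly_bounded T -> poly_bounded (fun n => for_time n (T n)).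
Proof.
move=> hT; apply: poly_bounded_add.
  apply: poly_bounded_S; apply: poly_bounded_mul poly_bounded_id _.
  by do 2!apply: poly_bounded_S.
apply: poly_bounded_add; last exact: poly_bounded_const.
by apply: poly_bounded_mul; [exact: poly_bounded_id|exact: poly_bounded_const].
Qed.

Lemma poly_goto_time : poly_bounded goto_time.
Proof.
have htimes T : poly_bounded T -> poly_bounded (fun n => times_time n (T n)).
  move=> hT; apply: poly_bounded_add; last exact: poly_bounded_const.
  apply: poly_bounded_add; apply: poly_bounded_mul; try exact: poly_bounded_id.
    by do 2!apply: poly_bounded_S.
  exact: poly_bounded_const.
have h1 := poly_bounded_const 1.
apply: poly_bounded_add => //; apply: poly_bounded_add.
  exact: htimes (poly_for_time (poly_for_time h1)).
by apply: poly_bounded_add; [exact: htimes (poly_for_time h1)|exact: htimes].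
Qed.

Definition is_mark (c : {ffun 'I_K -> option symb}) : bool :=
  c (inord L) == mark.

Definition homeC : comp symb K :=
  whileC (fun c => ~~ is_mark c) (moveC (on1 L MoveL)).

Lemma rep_mark w pos mc f ts : rep w pos mc f ts ->
  is_mark (scan ts) = (pos L == 0).
Proof.
move=> h; rewrite /is_mark (rep_scan _ h) inordK // /content ltnn eqxx.
by case: (pos L) => // p; case: (mc _).
Qed.

Lemma triple_home w pos p mc f :
  triple (rep w (set_pos pos L p) mc f) homeC (p * 2).+1
         (rep w (set_pos pos L 0) mc f).
Proof.
pose P k := rep w (set_pos pos L (p - k)) mc f.
have h : triple (P 0) homeC (p * 2).+1 (P p).
  apply: triple_while => [k|k ts kp hP|ts hP|k kp]; first exact: rep_stable.
  - by rewrite (rep_mark hP); posv.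
  - by rewrite (rep_mark hP); posv.
  apply: triple_move; first by posx.
  by move=> l; posv.
apply: (triple_conseq _ _ _ h) => // ts.
  by rewrite /P subn0.
by rewrite /P subnn.
Qed.

(** A store cell that was never written is blank and is read as [s0], so the store needs no
    initialisation. *)
Definition opC i (g : Sigma -> G -> S -> G * S) : comp symb K :=
  actC (fun c l => (match c (inord i), c (inord D.+4) with
    | Some (inl a), Some (inr (Some (inr f))) =>
        let s := if c (inord L) is Some (inr (Some (inl s))) then s else s0 in
        let: (f', s') := g a f s in
        if l == inord L :> 'I_K then store_cell s'
        else if l == inord D.+4 :> 'I_K then flag_cell f' else c l
    | _, _ => c l
    end, MoveN)).

Definition upd (mc : nat -> option S) p s :=
  fun q => if q == p then Some s else mc q.

Lemma triple_op i g w pos mc f x a p : i < L -> pos i = x.+1 -> onth w x = Some a ->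
  pos L = p.+1 -> pos D.+4 = 0 ->
  let: (f', s') := g a f (odflt s0 (mc p.+1)) in
  triple (rep w pos mc f) (opC i g) 1 (rep w pos (upd mc p.+1 s') f').
Proof.
move=> iL px wx pL pD; case eg: (g a f _) => [f' s'].
have vL : (inord L : 'I_K) = L :> nat by rewrite inordK //; lia.
have vD : (inord D.+4 : 'I_K) = D.+4 :> nat by rewrite inordK //; lia.
apply: triple_act => ts h l; rewrite /act.
have -> : scan ts (inord i) = Some (inl a).
  by rewrite (rep_scan _ h) inordK ?px /content ?iL /= ?wx //; lia.
have -> : scan ts (inord D.+4) = flag_cell f.
  rewrite (rep_scan _ h) vD pD /content ifF; last by lia.
  by rewrite ifF //; lia.
have -> : (if scan ts (inord L) is Some (inr (Some (inl s))) then s else s0)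
    = odflt s0 (mc p.+1).
  rewrite (rep_scan _ h) vL pL /content ltnn eqxx.
  by case: (mc _).
rewrite /= eg.
have lL : (l == inord L) = (l == L :> nat) by rewrite -val_eqE /= vL.
have lD : (l == inord D.+4) = (l == D.+4 :> nat) by rewrite -val_eqE /= vD.
rewrite lL lD.
apply: (@holds_move _ _ _ _ (pos l) _ MoveN (h l)) => // [|q hq]; rewrite /content.
  case: eqP => [->|hL]; first by rewrite ltnn pL /upd eqxx.
  case: eqP => [->|hD].
    by rewrite pD ifF //; lia.
  rewrite (rep_scan _ h) /content; case: ifP => // hl.
  by have := ltn_ord l; lia.
case: ifP => // h1; case: ifP => [/eqP e|h2].
  by case: q hq => // q; rewrite e pL /upd => /negPf ->.
case: q hq => //; have -> : l = D.+4 :> nat by have := ltn_ord l; lia.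
by rewrite pD.
Qed.

Fixpoint compile (d : nat) (c : cmd) : comp symb K :=
  match c with
  | Skip => moveC (fun _ => MoveN)
  | Op i j k g => seqC (gotoC i j k) (seqC (opC i g) homeC)
  | Seq c1 c2 => seqC (compile d c1) (compile d c2)
  | Loop c => forC d (compile d.+1 c)
  end.

Definition address_max n := n * (n * n) + n * n + n + 1.

Fixpoint compile_time (c : cmd) (n : nat) : nat :=
  match c with
  | Skip => 1
  | Op _ _ _ _ => goto_time n + (1 + (address_max n * 2).+1)
  | Seq c1 c2 => compile_time c1 n + compile_time c2 n
  | Loop c => for_time n (compile_time c n)
  end.

Lemma address_inj n x y z x' y' z' :
  x < n -> y < n -> z < n -> x' < n -> y' < n -> z' < n ->
  address n x y z = address n x' y' z' -> [/\ x = x', y = y' & z = z'].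
Proof.
move=> hx hy hz hx' hy' hz' [e].
have e' : (x * n + y) * n + z = (x' * n + y') * n + z' by nia.
have n0 : 0 < n by lia.
have ez : z = z'.
  by have := congr1 (modn^~ n) e'; rewrite !modnMDl !modn_small.
have exy : x * n + y = x' * n + y'.
  by have := congr1 (divn^~ n) e'; rewrite !divnMDl // !divn_small // !addn0.
split=> //; last first.
  by have := congr1 (modn^~ n) exy; rewrite !modnMDl !modn_small.
by have := congr1 (divn^~ n) exy; rewrite !divnMDl // !divn_small // !addn0.
Qed.

(** Agreement is required only at triples of positions of the word. Outside them [address] is not
    injective, and loop variables never leave them. *)
Definition srep w env (mf : store * G) (ts : tapes symb K) :=
  exists mc, rep w (pos_of env) mc mf.2 ts /\
    forall x y z, x < size w -> y < size w -> z < size w ->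
      odflt s0 (mc (address (size w) x y z)) = mf.1 x y z.

Lemma srep_stable w env mf : stable (srep w env mf).
Proof. by move=> ts [mc [h1 h2]]; exists mc; split=> //; apply: rep_stable. Qed.

Lemma triple_pre_srep w env mf C T Q :
  (forall mc, (forall x y z, x < size w -> y < size w -> z < size w ->
      odflt s0 (mc (address (size w) x y z)) = mf.1 x y z) ->
    triple (rep w (pos_of env) mc mf.2) C T Q) ->
  triple (srep w env mf) C T Q.
Proof. by move=> h ts [mc [h1 /h]]; apply. Qed.

Lemma triple_exec c w env mf : all (gtn (size w)) env -> size env <= D ->
  fits (size env) c ->
  triple (srep w env mf) (compile (size env) c) (compile_time c (size w))
         (srep w env (exec w c env mf)).
Proof.
elim: c env mf => [|i j k g|c1 IH1 c2 IH2|c IH] env mf hw hD hf.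
- apply: triple_pre_srep => mc hmc.
  have h : triple (rep w (pos_of env) mc mf.2) (moveC (fun _ => MoveN)) 1
      (rep w (pos_of env) mc mf.2) by apply: triple_move.
  by apply: (triple_conseq _ _ _ h) => // ts hr; exists mc.
- apply: triple_pre_srep => mc hmc.
  have h1 := @triple_goto w env i j k mc mf.2 hw hD hf.
  have /and3P[hi hj hk] := hf.
  set x := nth 0 env i in h1; set y := nth 0 env j in h1.
  set z := nth 0 env k in h1; set n := size w in hmc h1.
  have [xn yn zn] : [/\ x < n, y < n & z < n].
    by split; move/(all_nthP 0): hw; apply.
  have [a wx] : exists a, onth w x = Some a.
    by have := onthTE w x; rewrite xn; case: onth => // a _; exists a.
  have hpos v i' : i' < size env ->
      set_pos (pos_of env) L v i' = (nth 0 env i').+1.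
    move=> hi'; rewrite /set_pos /pos_of.
    by case: eqP => [|_]; [lia|case: ifP; lia].
  have h2 := @triple_op i g w (set_pos (pos_of env) L (address n x y z)) mc mf.2
    x a (x * (n * n) + y * n + z) _ (hpos _ _ hi) wx.
  have {}h2 := h2 (ltn_addr _ (leq_trans hi hD)).
  rewrite {1}/set_pos eqxx in h2; have {}h2 := h2 erefl.
  rewrite /set_pos ifF in h2; last by lia.
  rewrite {1}/pos_of ifF in h2; last by lia.
  have {}h2 := h2 erefl; rewrite -/(set_pos _ _ _) in h2.
  rewrite /= -/x -/y -/z wx.
  rewrite -[_.+1]/(address n x y z) hmc // in h2.
  case: (g _ _ _) h2 => f' s' h2.
  have h3 := @triple_home w (pos_of env) (address n x y z)
    (upd mc (address n x y z) s') f'.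
  apply: (triple_conseq _ _ _ (triple_seq h1 (triple_seq h2 h3))) => //.
    rewrite !leq_add2l ltnS leq_mul2r /= -/n /address /address_max.
    by nia.
  move=> ts h; exists (upd mc (address n x y z) s'); split.
    apply: rep_ext h => l; rewrite /set_pos /pos_of; case: eqP => // ->.
    by rewrite ltnn.
  move=> x' y' z' hx' hy' hz'; rewrite /upd /upd_store /=.
  case: eqP => [/address_inj|] e.
    by have [] := e; rewrite // => -> -> ->; rewrite !eqxx.
  rewrite ifF ?hmc //; apply/negP => /andP[/andP[/eqP ex /eqP ey] /eqP ez].
  by apply: e; rewrite ex ey ez.
- by move: hf => /= /andP[hf1 hf2]; apply: triple_seq; [exact: IH1|exact: IH2].
- move: hf => /= /andP[hd hf].
  pose st k := foldl (fun mf x => exec w c (rcons env x) mf) mf (iota 0 k).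
  pose P k := srep w (rcons env k) (st k).
  have dL : size env < L by lia.
  have posd k : pos_of (rcons env k) (size env) = k.+1.
    by rewrite /pos_of dL nth_rcons ltnn eqxx.
  have hpos k l : l != size env -> pos_of (rcons env k) l = pos_of env l.
    move=> hl; rewrite /pos_of nth_rcons (negPf hl).
    by case: (ltnP l (size env)) => // hl'; rewrite nth_default.
  have := @triple_for (size env) w (compile (size env).+1 c)
    (compile_time c (size w)).+1 P (srep w env (st (size w))) dL.
  move=> h; apply: (triple_conseq _ _ _ (h _ _ _ _)) => //.
  + move=> ts [mc [hr hm]]; exists mc; split=> //.
    apply: rep_ext hr => l; case: (eqVneq l (size env)) => [->|/hpos -> //].
    by rewrite posd /pos_of dL nth_default.
  + by move=> k; apply: srep_stable.
  + by move=> k ts [mc [hr _]]; do 3 eexists; split; first exact: hr.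
  + move=> k kn; rewrite -[(compile_time _ _).+1]addn1.
    have := IH (rcons env k) (st k); rewrite size_rcons all_rcons /= kn.
    move=> /(_ hw hd hf) h1; apply: triple_seq h1 _.
    have -> : exec w c (rcons env k) (st k) = st k.+1.
      by rewrite /st -[in RHS]addn1 iotaD foldl_cat.
    apply: triple_pre_srep => mc hm.
    have h2 : triple (rep w (pos_of (rcons env k)) mc (st k.+1).2)
        (moveC (on1 (size env) MoveR)) 1
        (rep w (pos_of (rcons env k.+1)) mc (st k.+1).2).
      apply: triple_move => l; rewrite /on1; last by case: eqP.
      by case: (eqVneq l (size env)) => [->|hl]; rewrite ?posd ?hpos.
    by apply: (triple_conseq _ _ _ h2) => // ts hr; exists mc.
  + apply: triple_pre_srep => mc hm.
    have h2 : triple (rep w (pos_of (rcons env (size w))) mc (st (size w)).2)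
        (rewindC (size env)) (size w * 2 + 3)
        (rep w (pos_of env) mc (st (size w)).2).
      apply: triple_rewind => [||l] //; first by rewrite posd /= leqnn.
      rewrite /set_pos; case: eqP => [->|/eqP hl]; last by rewrite hpos.
      by rewrite /pos_of dL nth_default.
    by apply: (triple_conseq _ _ _ h2) => // ts hr; exists mc.
Qed.

Lemma poly_compile_time c : poly_bounded (compile_time c).
Proof.
elim: c => [|i j k g|c1 h1 c2 h2|c h] /=.
- exact: poly_bounded_const.
- apply: poly_bounded_add poly_goto_time _.
  apply: poly_bounded_add (poly_bounded_const 1) _; apply: poly_bounded_S.
  apply: poly_bounded_mul (poly_bounded_const 2).
  have hi := poly_bounded_id; have h2 := poly_bounded_mul hi hi.
  apply: poly_bounded_add (poly_bounded_const 1).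
  by do 2!apply: poly_bounded_add => //; apply: poly_bounded_mul.
- exact: poly_bounded_add.
- exact: poly_for_time.
Qed.
End Loops.

Arguments mark {Sigma S G}.
Arguments flag_cell {Sigma S G}.
Arguments store_cell {Sigma S G}.
Arguments moveC {Sigma S G D}.
Arguments Skip {Sigma S G}.

Lemma poly_bounded_le T : poly_bounded T ->
  exists c k, forall n, T n <= c * n ^ k + c.
Proof.
(* The factor [2 ^ k] comes from [n.+1 <= 2 * n] for positive [n]; the additive constant takes care
   of the empty word. *)
move=> [C [k hT]]; exists (C * 2 ^ k), k => n.
apply: leq_trans (hT n) _; case: n => [|n].
  rewrite exp1n muln1; apply: leq_trans (leq_addl _ _).
  by rewrite leq_pmulr // expn_gt0.
apply: leq_trans (leq_addr _ _); rewrite -mulnA leq_mul2l -expnMn.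
apply/orP; right; case: k {hT} => // k.
by rewrite leq_exp2r //; lia.
Qed.

Lemma onth_take T (w : seq T) k q :
  onth (take k w) q = if q < k then onth w q else None.
Proof. by elim: w k q => [|a w IH] [|k] [|q] //=; [case: ifP|rewrite IH]. Qed.

(** Halting configurations are fixed. Hence the actual running time may be replaced by a bound that
    depends on the length alone. *)
Lemma answer_after_leq (Sigma : finType) (M : machine Sigma) w t t' b :
  t <= t' -> answer_after M t w = Some b -> answer_after M t' w = Some b.
Proof.
move=> /subnK <-; rewrite /answer_after iterD => h.
elim: (t' - t) => // n; rewrite iterS; case: (iter n _ _) => q ts /= hq.
by rewrite hq.
Qed.

(** * Initialisation of the tapes and the machine of a program *)

Section Machine.
Variables (Sigma S G : finType) (s0 : S) (g0 : G) (D : nat).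

Local Notation L := (D + 3).
Local Notation K := (D + 3).+2.
Local Notation symb := (symb Sigma S G).

Definition writeC : comp symb K :=
  actC (fun c l => (if l == L :> nat then mark
                    else if l == D.+4 :> nat then flag_cell g0
                    else c l, MoveN)).

Definition spreadC : comp symb K :=
  whileC (is_letter 0)
    (actC (fun c l => if l < L then (c (inord 0), MoveR) else (c l, MoveN))).

Definition shift (d : move) (l : nat) : move := if l < L then d else MoveN.

Definition initC : comp symb K :=
  seqC writeC (seqC spreadC (seqC (moveC (shift MoveL))
    (seqC (whileC (is_letter 0) (moveC (shift MoveL))) (moveC (shift MoveR))))).

Definition init_tapes (w : seq Sigma) : tapes symb K :=
  fun i => if i == ord0 then ([::], [seq Some (inl a) | a <- w]) else ([::], [::]).

Lemma triple_init w :
  triple (fun ts => ts = init_tapes w) initC (size w * 4 + 5)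
         (srep s0 w [::] (fun _ _ _ => s0, g0)).
Proof.
(* Cell 0 is taken to be the blank just left of the initial head, so the shift of the input by one
   cell is only a choice of origin. After [k] rounds the other input tapes carry the first [k]
   letters. *)
pose P k (ts : tapes symb K) := forall i : 'I_K,
  holds (ts i)
    (content D (if i == 0 :> nat then w else take k w) (fun _ => None) g0 i)
    (if i < L then k.+1 else 0).
have L0 : 0 < L by lia.
have h1 : triple (fun ts => ts = init_tapes w) writeC 1 (P 0).
  apply: triple_act => ts -> i; rewrite /act /init_tapes.
  have hb q : content (Sigma := Sigma) (S := S) D [::] (fun=> None) g0 i q =
    if q == 0 then if i < L then None else if i == L :> nat then mark
      else flag_cell g0 else None.
    rewrite /content /input_cell; case: q => [|q] //=.
    by rewrite onth0n /= !if_same.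
  case: (eqVneq i ord0) => [->|i0].
    have -> : (nat_of_ord (ord0 : 'I_K) == L) = false by rewrite /=; lia.
    have -> : (nat_of_ord (ord0 : 'I_K) == D.+4) = false by rewrite /=; lia.
    rewrite [nat_of_ord _]/= L0.
    apply: (@holds_move _ _ (content D w (fun=> None) g0 0) _ 1 _ MoveN) => //=.
      split=> [q|q]; rewrite /content L0; last by rewrite nth_nil; case: q.
      by rewrite /= onthE /=; elim: (w) (q) => [|a v IH] [].
    by rewrite ffunE /= /content L0 /=; case: (w).
  have i0' : (i == 0 :> nat) = false.
    by apply: contraNF i0 => /eqP e; apply/eqP/val_inj.
  rewrite i0' take0; case: (ltnP i L) => hi.
    have -> : (i == L :> nat) = false by apply: ltn_eqF.
    have -> : (i == D.+4 :> nat) = false by apply: ltn_eqF; lia.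
    apply: (@holds_move _ _ (fun=> None) _ 1 _ MoveN) => //=.
    - by split=> [q|q]; rewrite ?nth_nil ?if_same.
    - by rewrite ffunE (negPf i0) hb hi.
    - by move=> q _; rewrite hb hi; case: ifP.
  apply: (@holds_move _ _ (fun=> None) _ 0 _ MoveN) => //=.
  - by split=> [q|q]; rewrite ?nth_nil.
  - rewrite hb ltnNge hi /=; case: eqP => // hL; rewrite ifT //.
    by have := ltn_ord i; lia.
  - by case=> // q _; rewrite hb.
have L0' : (inord 0 : 'I_K) = 0 :> nat by rewrite inordK.
have let0 k ts : P k ts -> is_letter 0 (scan ts) = (k < size w).
  move=> h; rewrite /is_letter ffunE (holds_scan (h _)) L0' /content L0 /=.
  by rewrite -onthTE; case: onth.
have h2 : triple (P 0) spreadC (size w * 2).+1 (P (size w)).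
  apply: triple_while => [k ts h i|k ts kn /let0 ->|ts /let0 ->|k kn] //.
  - by rewrite /act /stay ffunE; apply: holds_stay.
  - exact: ltnn.
  have [a wk] : exists a, onth w k = Some a.
    by have := onthTE w k; rewrite kn; case: onth => // a _; exists a.
  apply: triple_act => ts h i; rewrite /act.
  have -> : scan ts (inord 0) = Some (inl a).
    by rewrite ffunE (holds_scan (h _)) L0' /content L0 /= wk.
  have := h i; case: (ltnP i L) => hi hP.
    apply: (holds_move hP) => //.
      rewrite /content hi /=; case: eqP => _; first by rewrite wk.
      by rewrite /= onth_take ltnSn wk.
    move=> q hq; rewrite /content hi; case: eqP => // _.
    case: q hq => // q hq /=; rewrite !onth_take.
    by congr omap; have -> : (q < k.+1) = (q < k) by lia.
  apply: (holds_move hP) => //.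
    by rewrite ffunE (holds_scan hP); case: eqP hi => // ->; rewrite leqNgt L0.
  move=> q _; rewrite /content ltnNge hi /=.
  by [].
pose Q v := rep (S := S) (D := D) w (fun i => if i < L then v else 0)
  (fun=> None) g0.
have move_all d v v' : move_pos d v = v' -> (d = MoveL -> 0 < v) ->
    triple (Q v) (moveC (shift d)) 1 (Q v').
  move=> e hv; apply: triple_move => l; rewrite /shift; by case: ifP.
have letQ v ts : v <= size w -> Q v ts -> is_letter 0 (scan ts) = (0 < v).
  by move=> hv h; rewrite (rep_letter L0 h) L0 hv andbT.
have h3 : triple (P (size w)) (moveC (shift MoveL)) 1 (Q (size w)).
  apply: (triple_conseq _ _ _ (move_all MoveL (size w).+1 _ erefl _)) => //.
  by move=> ts h i; have := h i; rewrite take_size if_same.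
have h4 : triple (Q (size w)) (whileC (is_letter 0) (moveC (shift MoveL)))
    (size w * 2).+1 (Q 0).
  pose R k := Q (size w - k).
  have h : triple (R 0) (whileC (is_letter 0) (moveC (shift MoveL)))
    (size w * 2).+1 (R (size w)).
    apply: triple_while => [k|k ts kn|ts|k kn]; first exact: rep_stable.
    - by move/letQ => -> //; lia.
    - by move/letQ => -> //; lia.
    by apply: move_all => /=; lia.
  by apply: (triple_conseq _ _ _ h) => // ts; rewrite /R ?subn0 ?subnn.
have h5 := move_all MoveR 0 1 erefl (fun e => ltac:(discriminate e)).
have := triple_seq h1 (triple_seq h2 (triple_seq h3 (triple_seq h4 h5))).
apply: triple_conseq => //; first by lia.
move=> ts h; exists (fun=> None); split=> //.
by apply: rep_ext h => i; rewrite /pos_of nth_nil.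
Qed.

Variables (c : cmd Sigma S G) (accept : G -> bool).

Definition progC : comp symb K := seqC initC (compile s0 D 0 c).

Definition loop_machine : machine Sigma :=
  @Machine Sigma L.+1 (option (S + G))%type (cstate progC + option bool)%type
    (inl (cstart progC)) (fun q => if q is inr b then b else None)
    (fun q cells =>
       match q with
       | inl s => let: (s', f) := cstep s cells in
           (if s' is Some s'' then inl s'' else inr None, f)
       | inr _ =>
           (inr (Some (if cells (inord D.+4) is Some (inr (Some (inr f)))
                       then accept f else false)), stay cells)
       end).

Lemma run_step_iter (s : cstate progC) ts t ts' : run s ts t ts' ->
  iter t (@step _ loop_machine) (inl s, ts) = (inr None, ts').
Proof.
have stepE s1 ts1 s2 f : cstep s1 (scan ts1) = (s2, f) ->
    @step _ loop_machine (inl s1, ts1) =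
    (if s2 is Some s3 then inl s3 else inr None, act f ts1).
  move=> e.
  have e' : @delta _ loop_machine (inl s1)
      [ffun i => @scanned _ loop_machine (ts1 i)] =
    (if s2 is Some s3 then inl s3 else inr None, f).
    have : (let: (s3, f3) := cstep s1 (scan ts1) in
        (if s3 is Some s4 then inl s4 else inr None, f3)) =
      (if s2 is Some s3 then inl s3 else inr (None : option bool), f) by rewrite e.
    exact.
  by rewrite /step /= in e' *; rewrite e'.
elim=> [s1 ts1 f e|s1 s2 ts1 f n ts2 e _ IH].
  exact: (stepE _ _ _ _ e).
by rewrite iterSr (stepE _ _ _ _ e) IH.
Qed.

Theorem loop_machineP w : fits D 0 c ->
  answer_after loop_machine (size w * 4 + 6 + compile_time c (size w)) w =
    Some (accept (exec w c [::] (fun _ _ _ => s0, g0)).2).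
Proof.
set mf := (fun _ _ _ => s0, g0); move=> hc.
have he := @triple_exec Sigma S G s0 D c w [::] mf isT (leq0n D) hc.
have [t [ts [ht hr [mc [hrep _]]]]] := triple_seq (@triple_init w) he erefl.
apply: (@answer_after_leq _ _ _ t.+1); first by lia.
have hflag : scan ts (inord D.+4) = flag_cell (exec w c [::] mf).2.
  rewrite (rep_scan _ hrep) inordK; last by lia.
  rewrite /content /pos_of ltnNge; have -> : L <= D.+4 by lia.
  by rewrite /= gtn_eqF //; lia.
have e : iter t (@step _ loop_machine) (init loop_machine w) = (inr None, ts).
  exact: run_step_iter hr.
rewrite /answer_after iterS e /=.
by rewrite -[[ffun i => _]]/(scan ts) hflag.
Qed.

End Machine.

Theorem exec_polytime (Sigma S G : finType) (s0 : S) (g0 : G) D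
    (c : cmd Sigma S G) (accept : G -> bool) (A : seq Sigma -> Prop) :
  fits D 0 c ->
  (forall w, accept (exec w c [::] (fun _ _ _ => s0, g0)).2 <-> A w) ->
  polytime_decidable A.
Proof.
move=> hc hA.
have hp : poly_bounded (fun n => n * 4 + 6 + compile_time c n).
  apply: poly_bounded_add (poly_compile_time c).
  apply: poly_bounded_add (poly_bounded_const 6).
  exact: poly_bounded_mul poly_bounded_id (poly_bounded_const 4).
have [C [k hC]] := poly_bounded_le hp.
exists (loop_machine s0 g0 D c accept), C, k => w; eexists; split; last exact: hA.
exact: answer_after_leq (hC (size w)) (loop_machineP s0 g0 accept w hc).
Qed.

(** * Datalog over words *)

Section ExecLoop.
Variables (Sigma S G : finType) (w : seq Sigma).
Local Notation n := (size w).
Local Notation state := (store S * G)%type.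

Lemma exec_loop (c : cmd Sigma S G) env (Q : nat -> state -> Prop) mf :
  Q 0 mf ->
  (forall k mf, k < n -> Q k mf -> Q k.+1 (exec w c (rcons env k) mf)) ->
  Q n (exec w (Loop c) env mf).
Proof.
move=> h0 hS; rewrite /=.
suff h k : k <= n ->
    Q k (foldl (fun mf x => exec w c (rcons env x) mf) mf (iota 0 k)).
  exact: h.
elim: k => // k IH kn; rewrite -addn1 iotaD foldl_cat /= addn1.
by apply: hS => //; apply: IH; apply: ltnW.
Qed.

Lemma exec_loop_keeps (c : cmd Sigma S G) env (Q : state -> Prop) mf :
  (forall k mf, k < n -> Q mf -> Q (exec w c (rcons env k) mf)) ->
  Q mf -> Q (exec w (Loop c) env mf).
Proof. by move=> hS h0; apply: (@exec_loop _ _ (fun _ => Q)). Qed.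

Lemma exec_loop_hits (c : cmd Sigma S G) env (Q R : state -> Prop) k0 mf :
  k0 < n -> Q mf ->
  (forall k mf, k < n -> Q mf -> Q (exec w c (rcons env k) mf)) ->
  (forall k mf, k < n -> R mf -> R (exec w c (rcons env k) mf)) ->
  (forall mf, Q mf -> R (exec w c (rcons env k0) mf)) ->
  R (exec w (Loop c) env mf).
Proof.
move=> k0n hQ keepQ keepR hit.
have := @exec_loop c env (fun k mf => Q mf /\ (k0 < k -> R mf)) mf.
case=> // [k mf' kn [hq hr]|_ hr]; last exact: hr.
split; first exact: keepQ.
rewrite ltnS leq_eqVlt => /orP[/eqP e|/hr]; last exact: keepR.
by rewrite -e; apply: hit.
Qed.

End ExecLoop.

Section Datalog.
Variables (Sigma P : finType).
Variables (letp : Sigma -> P) (succp firstp lastp goal : P).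

(* Predicates are ternary, and variables are numbered from 0 to 4. A unary
   fact p(x) is represented by p(x, x, x), a binary one by p(x, y, y). *)
Definition atom : eqType := (P * (nat * nat * nat))%type.
Definition rule : eqType := (seq atom * atom)%type.

Definition interp := P -> nat -> nat -> nat -> Prop.

Definition atom_holds (I : interp) (vs : seq nat) (a : atom) : Prop :=
  let: (p, (i, j, k)) := a in I p (nth 0 vs i) (nth 0 vs j) (nth 0 vs k).

Definition rule_holds (n : nat) (I : interp) (r : rule) : Prop :=
  forall vs, size vs = 5 -> all (gtn n) vs ->
  (forall a, a \in r.1 -> atom_holds I vs a) -> atom_holds I vs r.2.

Variable rules : seq rule.

Record model (w : seq Sigma) (I : interp) : Prop := Model {
  model_letter : forall x a, onth w x = Some a -> I (letp a) x x x;
  model_succ : forall x, x.+1 < size w -> I succp x x.+1 x.+1;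
  model_first : 0 < size w -> I firstp 0 0 0;
  model_last : forall x, x.+1 = size w -> I lastp x x x;
  model_rule : forall r, r \in rules -> rule_holds (size w) I r
}.

Definition atom_ok (a : atom) : bool :=
  let: (p, (i, j, k)) := a in [&& i < 5, j < 5 & k < 5].
Definition rule_ok (r : rule) : bool := all atom_ok r.1 && atom_ok r.2.

(* A cell also tells whether its three coordinates are equal. *)
Local Notation S := (bool * {set P})%type.
(** The first flag is working memory passed from one operation to the next; the second records
    whether a goal fact has been met. *)
Local Notation G := (bool * bool)%type.
Local Notation cmd := (cmd Sigma S G).
Local Notation store := (store S).

Definition Add i j k (g : G -> S -> bool * G) (p : P) : cmd :=
  Op i j k (fun _ f s =>
    ((g f s).2, (s.1, if (g f s).1 then p |: s.2 else s.2))).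

Definition add (m : store) x y z p (b : bool) : store :=
  upd_store m x y z ((m x y z).1, if b then p |: (m x y z).2 else (m x y z).2).

Lemma onth_ltn (w : seq Sigma) x : x < size w -> exists a, onth w x = Some a.
Proof. by rewrite -onthTE; case: onth => // a _; exists a. Qed.

Lemma exec_Seq w (c1 c2 : cmd) env mf :
  exec w (Seq c1 c2) env mf = exec w c2 env (exec w c1 env mf).
Proof. by []. Qed.

Lemma exec_Add w i j k g p env mf : nth 0 env i < size w ->
  let x := nth 0 env i in let y := nth 0 env j in let z := nth 0 env k in
  exec w (Add i j k g p) env mf =
  (add mf.1 x y z p (g mf.2 (mf.1 x y z)).1, (g mf.2 (mf.1 x y z)).2).
Proof. by move=> /onth_ltn[a /= ->]. Qed.

Definition fact (m : store) p x y z := p \in (m x y z).2.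

Lemma fact_add m x y z p b q x' y' z' : fact (add m x y z p b) q x' y' z' =
  fact m q x' y' z' || [&& b, q == p, x' == x, y' == y & z' == z].
Proof.
rewrite /fact /add /upd_store.
case: eqP => [->|] /=; last by rewrite !andbF orbF.
case: eqP => [->|] /=; last by rewrite !andbF orbF.
case: eqP => [->|] /=; last by rewrite !andbF orbF.
by case: b => /=; rewrite ?orbF // !inE andbT orbC.
Qed.

Lemma add1 m x y z p b x' y' z' : (add m x y z p b x' y' z').1 = (m x' y' z').1.
Proof.
by rewrite /add /upd_store; case: ifP => // /andP[/andP[/eqP-> /eqP->] /eqP->].
Qed.

(** The working flag is still false only at position 0, which is how the first position is
    recognised. The diagonal bits set here later allow two positions to be compared. *)
Definition letters_cmd : cmd :=
  Loop (Op 0 0 0 (fun a f s => ((true, f.2),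
    (true, letp a |: (if f.1 then s.2 else firstp |: s.2))))).

(** In the inner loop the working flag tells whether the preceding position was the outer one, in
    which case the current one is its successor. If the flag is set when the inner loop ends, the
    outer position is the last. *)
Definition order_cmd : cmd :=
  Loop (Seq (Add 0 0 0 (fun f _ => (false, (false, f.2))) succp)
       (Seq (Loop (Add 0 1 1 (fun f s => (f.1, (s.1, f.2))) succp))
            (Add 0 0 0 (fun f _ => (f.1, f)) lastp))).

Definition test_cmd (a : atom) : cmd :=
  let: (p, (i, j, k)) := a in
  Add (3 + i) (3 + j) (3 + k)
    (fun f s => (false, (f.1 && (p \in s.2), f.2))) p.

Definition rule_cmd (r : rule) : cmd :=
  let: (p, (i, j, k)) := r.2 in
  Seq (Add 3 3 3 (fun f _ => (false, (true, f.2))) goal)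
  (Seq (foldr (fun a c => Seq (test_cmd a) c) Skip r.1)
       (Add (3 + i) (3 + j) (3 + k) (fun f _ => (f.1, f)) p)).

Definition pass_cmd : cmd :=
  Loop (Loop (Loop (Loop (Loop
    (foldr (fun r c => Seq (rule_cmd r) c) Skip rules))))).

(* Every pass adds a fact until the store is closed under the rules. *)
Definition closure_cmd : cmd :=
  Loop (Loop (Loop (iter #|P|.+1 (Seq pass_cmd) Skip))).

Definition goal_cmd : cmd :=
  Loop (Loop (Loop (Add 0 1 2
    (fun f s => (false, (f.1, f.2 || (goal \in s.2)))) goal))).

Definition datalog_cmd : cmd :=
  Seq letters_cmd (Seq order_cmd (Seq closure_cmd goal_cmd)).

(** * Correctness of the Datalog evaluator on a given word *)

Section Word.
Variable w : seq Sigma.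
Local Notation n := (size w).

Definition sound (I : interp) (m : store) :=
  forall p x y z, fact m p x y z -> I p x y z.

Lemma sound_add (I : interp) m x y z p (b : bool) :
  sound I m -> (b -> I p x y z) -> sound I (add m x y z p b).
Proof.
move=> hs hb q x' y' z'; rewrite fact_add => /orP[/hs //|].
by case/and5P => /hb h /eqP-> /eqP-> /eqP-> /eqP->.
Qed.

Definition diagonal (k : nat) (m : store) :=
  forall x y z, (m x y z).1 = [&& x == y, y == z & x < k].

Definition has_letters (k : nat) (m : store) :=
  (forall x a, x < k -> onth w x = Some a -> fact m (letp a) x x x) /\
  (0 < k -> fact m firstp 0 0 0).

Lemma letters_cmdP (I : interp) : model w I ->
  let mf := exec w letters_cmd [::] (fun _ _ _ => (false, set0), (false, false)) in
  [/\ diagonal n mf.1, sound I mf.1, has_letters n mf.1 & mf.2.2 = false].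
Proof.
move=> hI.
pose Q k (mf : store * G) := [/\ diagonal k mf.1, sound I mf.1,
  has_letters k mf.1, mf.2.2 = false & mf.2.1 = (0 < k)].
suff: Q n (exec w letters_cmd [::] (fun _ _ _ => (false, set0), (false, false))).
  by case.
apply: exec_loop => [|k [m f] kn [/= hd hs [hl hf] f2 f1]].
  split=> //= [x y z|p x y z]; first by rewrite ltn0 !andbF.
  by rewrite /fact inE.
have [a wk] := onth_ltn kn; rewrite /= wk.
pose s := if f.1 then (m k k k).2 else firstp |: (m k k k).2.
have upd x y z : upd_store m k k k (true, letp a |: s) x y z =
    if [&& x == k, y == k & z == k] then (true, letp a |: s) else m x y z.
  by rewrite /upd_store andbA.
split=> //= [x y z|p x y z|]; rewrite -/s.
- rewrite upd; case: eqP => [->|xk] /=.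
    case: eqP => [->|yk] /=; last by rewrite hd; case: eqP yk => //; lia.
    case: eqP => [->|zk] /=; first by rewrite !eqxx ltnSn.
    by rewrite hd; case: eqP zk => //; lia.
  rewrite hd; case: eqP => //= exy; case: eqP => //= eyz.
  by lia.
- rewrite /fact upd; case: ifP => [/and3P[/eqP-> /eqP-> /eqP->]|_]; last exact: hs.
  rewrite in_setU1 => /orP[/eqP->|]; first exact: (model_letter hI).
  rewrite /s f1; case: ltnP => hk; first exact: hs.
  rewrite in_setU1 => /orP[/eqP->|]; last exact: hs.
  move: kn; have -> : k = 0 by lia.
  exact: (model_first hI).
- split=> [x b hx wx|_].
    rewrite /fact upd; case: eqP => [e|xk] /=.
      by move: wx; rewrite e wk => -[->]; rewrite !inE eqxx.
    by apply: hl => //; lia.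
  rewrite /fact upd; case: eqP => [e|] /=; last by move=> h; apply: hf; lia.
  by rewrite /s f1 -e !inE eqxx orbT.
Qed.

Definition base (I : interp) (mf : store * G) :=
  [/\ diagonal n mf.1, sound I mf.1, has_letters n mf.1 & mf.2.2 = false].

Lemma base_add I (mf : store * G) x y z p (b : bool) (f : G) : base I mf ->
  (b -> I p x y z) -> f.2 = false -> base I (add mf.1 x y z p b, f).
Proof.
move=> [hd hs [hl hf] f2] hb f2'; split=> //=.
- by move=> x' y' z'; rewrite add1.
- exact: sound_add.
by split=> [x' a hx hw|h]; rewrite fact_add ?hl ?hf.
Qed.

Definition has_order (k : nat) (m : store) := forall x, x < k ->
  (x.+1 < n -> fact m succp x x.+1 x.+1) /\ (x.+1 = n -> fact m lastp x x x).

Lemma has_order_add k m x y z p b :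
  has_order k m -> has_order k (add m x y z p b).
Proof.
by move=> h l /h[h1 h2]; split=> hl; rewrite fact_add ?h1 ?h2.
Qed.

Lemma order_cmdP (I : interp) mf : model w I -> base I mf ->
  base I (exec w order_cmd [::] mf) /\ has_order n (exec w order_cmd [::] mf).1.
Proof.
move=> hI hB; pose Q k mf := base I mf /\ has_order k mf.1.
apply: (@exec_loop _ _ _ _ _ _ Q) => // k {hB}mf kn [hB ho].
rewrite [rcons _ _]/= [exec _ _ _ _]/=; have [a wk] := onth_ltn kn.
rewrite -[foldl _ _ _]/(exec w
  (Loop (Add 0 1 1 (fun f s => (f.1, (s.1, f.2))) succp)) [:: k] _).
set mf1 := (X in exec _ (Loop _) _ X).
have [hB1 ho1 f1] : [/\ base I mf1, has_order k mf1.1 & mf1.2.1 = false].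
  rewrite /mf1 wk; split=> //; last exact: (@has_order_add _ _ _ _ _ succp false).
  by apply: (@base_add I mf k k k succp false) => //; case: hB.
pose R y mf := [/\ base I mf, has_order k mf.1, mf.2.1 = (y == k.+1) &
  k.+1 < y -> fact mf.1 succp k k.+1 k.+1].
set mf2 := exec _ _ _ _.
have [hB2 ho2 f2 hs2] : R n mf2.
  apply: exec_loop => // y mf' yn [hB' ho' f' hs'].
  rewrite exec_Add //=; have [hd' _ _ f2'] := hB'.
  split=> //=.
  - by apply: base_add => // e; move: yn; rewrite (eqP (etrans (esym f') e));
      exact: (model_succ hI).
  - exact: has_order_add.
  - by rewrite hd' eqxx kn /= andbT eqSS eq_sym.
  - rewrite ltnS leq_eqVlt fact_add => /orP[/eqP e|/hs' -> //].
    by rewrite f' -e !eqxx orbT.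
rewrite wk; split.
  apply: (@base_add I mf2 k k k lastp mf2.2.1) => //; last by case: hB2.
  by rewrite f2 => /eqP e; exact: (model_last hI).
move=> x; rewrite ltnS leq_eqVlt => /orP[/eqP->|]; last exact: has_order_add.
split=> hk; rewrite [fact _ _ _ _ _](@fact_add mf2.1 k k k lastp mf2.2.1).
  by rewrite hs2.
by rewrite f2 -hk !eqxx orbT.
Qed.

(** A test writes its cell back unchanged. As stores are functions, this and the lemmas that follow
    speak of pointwise agreement. *)
Lemma add_false m x y z p x' y' z' : add m x y z p false x' y' z' = m x' y' z'.
Proof.
rewrite /add /upd_store; case: ifP => // /andP[/andP[/eqP-> /eqP->] /eqP->].
by case: (m x y z).
Qed.

Definition atom_fact (m : store) (vs : seq nat) (a : atom) : bool :=
  let: (p, (i, j, k)) := a in fact m p (nth 0 vs i) (nth 0 vs j) (nth 0 vs k).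

Lemma exec_tests pre vs body mf : size pre = 3 -> size vs = 5 ->
  all (gtn n) vs -> all atom_ok body ->
  let mf' := exec w (foldr (fun a c => Seq (test_cmd a) c) Skip body)
               (pre ++ vs) mf in
  (forall x y z, mf'.1 x y z = mf.1 x y z) /\
  mf'.2 = (mf.2.1 && all (atom_fact mf.1 vs) body, mf.2.2).
Proof.
move=> s3 s5 hvs; elim: body mf => [|[p [[i j] k]] body IH] mf.
  by case: mf => m [f1 f2] _; rewrite /= andbT.
move=> /andP[/and3P[hi hj hk] hb].
have nthE l : nth 0 (pre ++ vs) (3 + l) = nth 0 vs l.
  by rewrite nth_cat s3 ltnNge leq_addr /= addKn.
have hin : nth 0 (pre ++ vs) (3 + i) < n.
  by rewrite nthE; move/(all_nthP 0): hvs; apply; rewrite s5.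
rewrite [foldr _ _ _]/= exec_Seq exec_Add // !nthE; set mf1 := (add _ _ _ _ _ _, _).
have e x y z : mf1.1 x y z = mf.1 x y z by apply: add_false.
have [h1 h2] := IH mf1 hb.
split=> [x y z|]; first by rewrite h1 e.
have el : all (atom_fact mf1.1 vs) body = all (atom_fact mf.1 vs) body.
  by apply: eq_all => -[q [[i' j'] k']]; rewrite /atom_fact /fact e.
by rewrite h2 el /= andbA.
Qed.

Lemma exec_rule pre vs (r : rule) mf : size pre = 3 -> size vs = 5 ->
  all (gtn n) vs -> rule_ok r ->
  let: (p, (i, j, k)) := r.2 in
  let mf' := exec w (rule_cmd r) (pre ++ vs) mf in
  (forall x y z, mf'.1 x y z =
    add mf.1 (nth 0 vs i) (nth 0 vs j) (nth 0 vs k) p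
      (all (atom_fact mf.1 vs) r.1) x y z) /\
  mf'.2.2 = mf.2.2.
Proof.
move=> s3 s5 hvs /andP[hb]; rewrite /rule_cmd.
case: r.2 => p [[i j] k] /and3P[hi hj hk].
have nthE l : nth 0 (pre ++ vs) (3 + l) = nth 0 vs l.
  by rewrite nth_cat s3 ltnNge leq_addr /= addKn.
have hin l : l < 5 -> nth 0 (pre ++ vs) (3 + l) < n.
  by rewrite nthE => hl; move/(all_nthP 0): hvs; apply; rewrite s5.
rewrite !exec_Seq (exec_Add (i := 3)); last exact: (hin 0).
set mf1 := (add _ _ _ _ _ _, _).
have e x y z : mf1.1 x y z = mf.1 x y z by apply: add_false.
have [h1 h2] := exec_tests mf1 s3 s5 hvs hb.
set mf2 := exec _ (foldr _ _ _) _ _ in h1 h2 *.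
rewrite exec_Add ?hin // !nthE; split=> [x y z|]; last by rewrite h2.
rewrite h2 /= /add /upd_store h1 e; case: ifP => _; last by rewrite h1 e.
suff -> : all (atom_fact mf1.1 vs) r.1 = all (atom_fact mf.1 vs) r.1 by [].
by apply: eq_all => -[q [[i' j'] k']]; rewrite /atom_fact /fact e.
Qed.

Definition leS (m m' : store) := forall p x y z, fact m p x y z -> fact m' p x y z.

Definition eqD (m m' : store) := forall p x y z,
  x < n -> y < n -> z < n -> fact m p x y z = fact m' p x y z.

(** The potential that bounds the number of passes: it counts the facts about positions of the
    word. *)
Definition mu (m : store) := \sum_(t : 'I_n * 'I_n * 'I_n) #|(m t.1.1 t.1.2 t.2).2|.

Lemma leS_mu_leqif m m' : leS m m' -> mu m <= mu m' ?= iff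
  [forall t : 'I_n * 'I_n * 'I_n, (m t.1.1 t.1.2 t.2).2 == (m' t.1.1 t.1.2 t.2).2].
Proof.
move=> h; apply: (leqif_sum (P := xpredT)) => t _; apply: subset_leqif_cards.
by apply/subsetP => p; apply: h.
Qed.

Lemma leS_mu m m' : leS m m' -> mu m <= mu m'.
Proof. by move=> h; apply: (leS_mu_leqif h). Qed.

Lemma mu_eqD m m' : leS m m' -> mu m' <= mu m -> eqD m m'.
Proof.
move=> h hm p x y z xn yn zn.
have := geq_leqif (leS_mu_leqif h); rewrite hm => /esym/forallP.
move=> /(_ (Ordinal xn, Ordinal yn, Ordinal zn)).
by rewrite /fact => /eqP /= ->.
Qed.

Lemma mu_max m : mu m <= n * (n * n) * #|P|.
Proof.
apply: (@leq_trans (\sum_(t : 'I_n * 'I_n * 'I_n) #|P|)).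
  by apply: leq_sum => t _; apply: max_card.
by rewrite sum_nat_const !card_prod !card_ord mulnA.
Qed.

Definition respects (C : store -> Prop) := forall m m', eqD m m' -> C m -> C m'.

(** [F] only adds facts; if it adds none in range, [C] holds afterwards, and where [C] holds already
    it adds none in range. In this form the property passes to compositions and loops, whereas a
    later step may destroy closure that an earlier one achieved. *)
Definition grows (C : store -> Prop) (F : store * G -> store * G) :=
  respects C /\ forall mf, [/\ leS mf.1 (F mf).1,
    mu (F mf).1 <= mu mf.1 -> C (F mf).1 & C mf.1 -> eqD mf.1 (F mf).1].

Lemma grows_skip C : respects C -> (forall m, C m) -> grows C id.
Proof. by move=> hr h; split=> // mf; split. Qed.

Lemma eqD_trans m1 m2 m3 : eqD m1 m2 -> eqD m2 m3 -> eqD m1 m3.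
Proof. by move=> h1 h2 p x y z xn yn zn; rewrite h1 // h2. Qed.

(** If the potential does not rise over both steps, it rises in neither. The second step then
    changes nothing in range, so [C1] carries over to its result. *)
Lemma grows_seq C1 C2 F1 F2 : grows C1 F1 -> grows C2 F2 ->
  grows (fun m => C1 m /\ C2 m) (fun mf => F2 (F1 mf)).
Proof.
move=> [r1 g1] [r2 g2]; split=> [m m' e [c1 c2]|mf].
  by split; [apply: r1 c1|apply: r2 c2].
have [l1 m1 e1] := g1 mf; have [l2 m2 e2] := g2 (F1 mf).
split=> [p x y z /l1/l2 //|hm|[c1 c2]].
  have h1 := leS_mu l1; have h2 := leS_mu l2.
  split; last by apply: m2; apply: leq_trans h1.
  apply: (r1 (F1 mf).1); first by apply: mu_eqD => //; apply: leq_trans h1.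
  by apply: m1; apply: leq_trans hm.
by apply: (eqD_trans (e1 c1)); apply: e2; apply: r2 c2; apply: e1.
Qed.

Lemma grows_ext (C C' : store -> Prop) F :
  (forall m, C m <-> C' m) -> grows C F -> grows C' F.
Proof.
move=> e [r g]; split=> [m m' em /e h|mf]; first by apply/e; apply: r h.
by have [h1 h2 h3] := g mf; split=> // [/h2/e|/e].
Qed.

Lemma grows_loop (C : nat -> store -> Prop) (c : cmd) env :
  (forall k, k < n -> grows (C k) (exec w c (rcons env k))) ->
  grows (fun m => forall k, k < n -> C k m) (exec w (Loop c) env).
Proof.
move=> h; rewrite /=.
suff hj j : j <= n -> grows (fun m => forall k, k < j -> C k m)
    (fun mf => foldl (fun mf x => exec w c (rcons env x) mf) mf (iota 0 j)).
  exact: hj.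
elim: j => [|j IH] jn; first by apply: grows_skip => // m m' _ hC k.
have hg := grows_seq (IH (ltnW jn)) (h j jn).
split=> [m m' e hC k kj|mf].
  have kn : k < n by lia.
  by have [r _] := h k kn; apply: r (hC k kj).
have [_ /(_ mf)] := hg; rewrite -addn1 iotaD foldl_cat /= add0n => -[h1 h2 h3].
split=> // [hm k|hC].
  have [hC1 hC2] := h2 hm; rewrite addn1 ltnS leq_eqVlt => /orP[/eqP-> //|].
  exact: hC1.
by apply: h3; split=> [k kj|]; apply: hC; lia.
Qed.

Definition closed_at (vs : seq nat) (r : rule) (m : store) :=
  all (atom_fact m vs) r.1 -> atom_fact m vs r.2.

Lemma eqD_atom m m' vs a : eqD m m' -> size vs = 5 -> all (gtn n) vs ->
  atom_ok a -> atom_fact m vs a = atom_fact m' vs a.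
Proof.
case: a => p [[i j] k] e s5 /(all_nthP 0) hvs /and3P[hi hj hk] /=.
by apply: e; apply: hvs; rewrite s5.
Qed.

Lemma grows_rule pre vs r : size pre = 3 -> size vs = 5 -> all (gtn n) vs ->
  rule_ok r -> grows (closed_at vs r) (exec w (rule_cmd r) (pre ++ vs)).
Proof.
move=> s3 s5 hvs hr; have /andP[/allP hb hh] := hr.
have eqb m m' : eqD m m' -> all (atom_fact m vs) r.1 = all (atom_fact m' vs) r.1.
  by move=> e; apply: eq_in_all => a /hb ha; apply: eqD_atom.
split=> [m m' e hC|mf].
  by rewrite /closed_at -(eqb _ _ e) -(eqD_atom e).
have := exec_rule mf s3 s5 hvs hr.
rewrite /closed_at.
case: r.2 hh => p [[i j] k] hh [].
set m' := (exec _ _ _ _).1 => hm _; rewrite -/m'.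
have hf q x y z : fact m' q x y z = fact (add mf.1 (nth 0 vs i) (nth 0 vs j)
    (nth 0 vs k) p (all (atom_fact mf.1 vs) r.1)) q x y z.
  by rewrite /fact hm.
have le : leS mf.1 m' by move=> q x y z h; rewrite hf fact_add h.
split=> // [hmu|hC q x y z xn yn zn].
  rewrite -(eqb _ _ (mu_eqD le hmu)) => hall.
  by rewrite /= hf fact_add hall !eqxx orbT.
rewrite hf fact_add; case: (fact mf.1 q x y z) / idP => //= hn; apply/esym/negP.
case/and5P => /hC h /eqP e /eqP ex /eqP ey /eqP ez; apply: hn.
by rewrite e ex ey ez.
Qed.

Definition loaded (I : interp) (mf : store * G) := base I mf /\ has_order n mf.1.

Lemma loaded_eq I (mf mf' : store * G) :
  (forall x y z, mf'.1 x y z = mf.1 x y z) -> mf'.2.2 = mf.2.2 ->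
  loaded I mf -> loaded I mf'.
Proof.
move=> e e2 [[hd hs [hl hf] f2] ho].
have ef p x y z : fact mf'.1 p x y z = fact mf.1 p x y z by rewrite /fact e.
split; first split.
- by move=> x y z; rewrite e.
- by move=> p x y z; rewrite ef; apply: hs.
- by split=> [x a hx hw|h]; rewrite ef; [apply: hl|apply: hf].
- by rewrite e2.
by move=> x /ho[h1 h2]; rewrite !ef.
Qed.

Lemma loaded_rule I pre vs r mf : model w I -> r \in rules -> rule_ok r ->
  size pre = 3 -> size vs = 5 -> all (gtn n) vs -> loaded I mf ->
  loaded I (exec w (rule_cmd r) (pre ++ vs) mf).
Proof.
move=> hI hr hok s3 s5 hvs [hb ho].
have := exec_rule mf s3 s5 hvs hok; case er: r.2 => [p [[i j] k]] [e e2].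
apply: (@loaded_eq I (add mf.1 (nth 0 vs i) (nth 0 vs j) (nth 0 vs k) p
  (all (atom_fact mf.1 vs) r.1), mf.2)) => //.
split; last exact: has_order_add.
apply: base_add => // [/allP hall|]; last by case: hb.
have := model_rule hI hr s5 hvs; rewrite er; apply => a /hall.
have [_ hs _ _] := hb.
by case: a => q [[i' j'] k'] /hs.
Qed.

Hypothesis rules_ok : all rule_ok rules.

Lemma rcons5 (T : Type) (pre : seq T) k1 k2 k3 k4 k5 :
  rcons (rcons (rcons (rcons (rcons pre k1) k2) k3) k4) k5 =
  pre ++ [:: k1; k2; k3; k4; k5].
Proof. by rewrite -!cats1 -!catA. Qed.

Lemma loaded_pass I pre mf : model w I -> size pre = 3 -> loaded I mf ->
  loaded I (exec w pass_cmd pre mf).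
Proof.
move=> hI s3; do 5!apply: exec_loop_keeps => ? ? ?; rewrite rcons5.
set vs := [:: _; _; _; _; _].
have hvs : all (gtn n) vs by apply/and5P; split=> //; apply/andP.
suff h rs mf' : {subset rs <= rules} -> loaded I mf' -> loaded I
    (exec w (foldr (fun r c => Seq (rule_cmd r) c) Skip rs) (pre ++ vs) mf').
  exact: h.
elim: rs mf' => [//|r rs IH] mf' hrs hm; rewrite [foldr _ _ _]/= exec_Seq.
apply: IH => [r' hr'|]; first by apply: hrs; rewrite inE hr' orbT.
have hr : r \in rules by apply: hrs; rewrite inE eqxx.
by apply: loaded_rule => //; apply: (allP rules_ok).
Qed.

Definition closed (m : store) := forall vs, size vs = 5 -> all (gtn n) vs ->
  forall r, r \in rules -> closed_at vs r m.

Lemma grows_pass pre : size pre = 3 -> grows closed (exec w pass_cmd pre).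
Proof.
move=> s3; pose C k1 k2 k3 k4 k5 m := forall r, r \in rules ->
  closed_at [:: k1; k2; k3; k4; k5] r m.
apply: (@grows_ext (fun m => forall k1, k1 < n -> forall k2, k2 < n ->
  forall k3, k3 < n -> forall k4, k4 < n -> forall k5, k5 < n ->
  C k1 k2 k3 k4 k5 m)).
  move=> m; split=> [h|h k1 l1 k2 l2 k3 l3 k4 l4 k5 l5].
    case=> [|k1 [|k2 [|k3 [|k4 [|k5 []]]]]] // _.
    by move=> /and5P[l1 l2 l3 l4 /andP[l5 _]]; apply: h.
  by apply: h => //; apply/and5P; split=> //; apply/andP.
apply: grows_loop => k1 l1; apply: grows_loop => k2 l2.
apply: grows_loop => k3 l3; apply: grows_loop => k4 l4.
apply: grows_loop => k5 l5; rewrite rcons5; rewrite /C.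
set vs := [:: _; _; _; _; _].
have hvs : all (gtn n) vs by apply/and5P; split=> //; apply/andP.
elim: rules rules_ok => [_|r rs IH /andP[hr hrs]].
  exact: grows_skip.
apply: grows_ext (grows_seq (grows_rule s3 _ hvs hr) (IH hrs)) => // m.
split=> [[h1 h2] r'|h]; last first.
  by split=> [|r' hr']; apply: h; rewrite inE ?eqxx ?hr' ?orbT.
by rewrite inE => /orP[/eqP->|/h2].
Qed.

Definition progress j (mf : store * G) := closed mf.1 \/ j <= mu mf.1.

Lemma progress_loop (c : cmd) env N j mf :
  (forall k j mf, k < n -> progress j mf ->
     progress (j + N) (exec w c (rcons env k) mf)) ->
  progress j mf -> progress (j + n * N) (exec w (Loop c) env mf).
Proof.
move=> h h0; apply: (@exec_loop _ _ _ _ _ _ (fun k => progress (j + k * N))).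
  by rewrite addn0.
by move=> k mf' kn /(h k) => /(_ kn); rewrite -addnA mulSn [N + _]addnC.
Qed.

Lemma progress_pass pre j mf : size pre = 3 -> progress j mf ->
  progress j.+1 (exec w pass_cmd pre mf).
Proof.
move=> /grows_pass[hr /(_ mf)[hl hm hc]] [h|h]; first by left; apply: hr (hc h) h.
case: (leqP (mu (exec w pass_cmd pre mf).1) (mu mf.1)) => [/hm|hlt].
  by left.
by right; apply: leq_ltn_trans hlt.
Qed.

(** Each pass that does not reach closure raises [mu], and with [n] the length of the word there are
    [n ^ 3 * (#|P| + 1)] passes, while [mu] is at most [n ^ 3 * #|P|]. For the empty word closure is
    vacuous. *)
Lemma closure_cmdP mf : closed (exec w closure_cmd [::] mf).1.
Proof.
have : progress (0 + n * (n * (n * #|P|.+1))) (exec w closure_cmd [::] mf).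
  apply: progress_loop => [k1 j1 mf1 _|]; last by right.
  apply: progress_loop => k2 j2 mf2 _; apply: progress_loop => k3 j3 mf3 _.
  rewrite [rcons _ k3]/=; elim: #|P|.+1 j3 mf3 => [|t IH] j3 mf3 h.
    by rewrite addn0.
  by rewrite [iter _ _ _]/= exec_Seq -addSnnS; apply: IH; apply: progress_pass.
case=> // h; have := leq_trans h (mu_max _); case: (posnP n) => [n0 _|n0].
  by case=> [|x vs] //= _ /andP[]; rewrite n0.
rewrite add0n -mulnA leq_mul2l; lia.
Qed.

Lemma loaded_closure I mf : model w I -> loaded I mf ->
  loaded I (exec w closure_cmd [::] mf).
Proof.
move=> hI; apply: exec_loop_keeps => k1 mf1 _; apply: exec_loop_keeps => k2 mf2 _.
apply: exec_loop_keeps => k3 mf3 _; rewrite [rcons _ k3]/=.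
elim: #|P|.+1 mf3 => [//|t IH] mf' h.
by rewrite [iter _ _ _]/= exec_Seq; apply: IH; apply: loaded_pass.
Qed.

Lemma goal_cmdP mf : mf.2.2 = false ->
  (exec w goal_cmd [::] mf).2.2 <->
  exists x y z, [/\ x < n, y < n, z < n & fact mf.1 goal x y z].
Proof.
move=> f2.
pose same (mf' : store * G) :=
  forall p x y z, fact mf'.1 p x y z = fact mf.1 p x y z.
pose cell := Add 0 1 2 (fun f s => (false, (f.1, f.2 || (goal \in s.2)))) goal.
have cellE x y z mf' : x < n -> exec w cell [:: x; y; z] mf' =
    (add mf'.1 x y z goal false, (mf'.2.1, mf'.2.2 || fact mf'.1 goal x y z)).
  by move=> xn; rewrite exec_Add.
have same_cell x y z mf' : x < n -> same mf' -> same (exec w cell [:: x; y; z] mf').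
  by move=> xn h p x' y' z'; rewrite cellE // fact_add orbF h.
split; last first.
  case=> x [y [z [xn yn zn hg]]].
  pose R (mf' : store * G) := mf'.2.2.
  have keepR x' y' z' mf' : x' < n -> R mf' -> R (exec w cell [:: x'; y'; z'] mf').
    by move=> x'n h; rewrite cellE // /R /= [mf'.2.2]h.
  apply: (exec_loop_hits (Q := same) (R := R) xn) => //.
  - move=> x' mf' x'n; apply: exec_loop_keeps => y' mf2 _.
    by apply: exec_loop_keeps => z' mf3 _; apply: same_cell.
  - move=> x' mf' x'n; apply: (exec_loop_keeps (Q := R)) => y' mf2 _.
    by apply: (exec_loop_keeps (Q := R)) => z' mf3 _; apply: keepR.
  move=> mf1 h1; apply: (exec_loop_hits (Q := same) (R := R) yn) => //.
  - by move=> y' mf2 _; apply: exec_loop_keeps => z' mf3 _; apply: same_cell.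
  - by move=> y' mf2 _; apply: (exec_loop_keeps (Q := R)) => z' mf3 _; apply: keepR.
  move=> mf2 h2; apply: (exec_loop_hits (Q := same) (R := R) zn) => //.
  - by move=> z' mf3 _; apply: same_cell.
  - by move=> z' mf3 _; apply: keepR.
  by move=> mf3 h3; rewrite cellE // /R /= h3 hg orbT.
move=> h; suff: exists x y z, [/\ x < n, y < n, z < n & fact mf.1 goal x y z] by [].
pose Q (mf' : store * G) := same mf' /\ (mf'.2.2 ->
  exists x y z, [/\ x < n, y < n, z < n & fact mf.1 goal x y z]).
suff [_] : Q (exec w goal_cmd [::] mf) by apply.
apply: exec_loop_keeps => [x mf1 xn|]; last by split=> //; rewrite f2.
apply: exec_loop_keeps => y mf2 yn; apply: exec_loop_keeps => z mf3 zn [h1 h2].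
split; first exact: same_cell.
rewrite cellE //= => /orP[//|]; rewrite h1 => hg.
by exists x, y, z.
Qed.

(** The computed store is itself a model and is contained in every other one, so it has a goal fact
    only if all models have one. *)
Lemma datalog_cmdP :
  ~~ (exec w datalog_cmd [::]
        (fun _ _ _ => (false, set0), (false, false))).2.2 <->
  exists I, model w I /\ forall x y z, x < n -> y < n -> z < n -> ~ I goal x y z.
Proof.
set mf0 := (_, (false, false)); rewrite !exec_Seq.
set mf1 := exec w letters_cmd _ _; set mf2 := exec w order_cmd _ _.
set mf3 := exec w closure_cmd _ _.
have hload I : model w I -> loaded I mf3.
  move=> hI; apply: loaded_closure => //.
  by apply: order_cmdP => //; apply: letters_cmdP.
(* The interpretation in which all facts hold is always a model; it serves to extract from [loaded]
   what does not depend on the model. *)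
have hT : model w (fun _ _ _ _ => True).
  by split=> // r _ vs _ _ _; case: r.2 => p [[i j] k].
have [[_ _ [hl hf] f2] ho] := hload _ hT.
split=> [/negP hn|[I [hI hg]]]; last first.
  apply/negP => /(goal_cmdP f2)[x [y [z [xn yn zn h]]]].
  by have [[_ hs _ _] _] := hload _ hI; apply: (hg x y z) => //; apply: hs.
exists (fact mf3.1); split; last first.
  by move=> x y z xn yn zn h; apply: hn; apply/(goal_cmdP f2); exists x, y, z.
split=> // [x a wx|x xn|x xn|r hr vs s5 hvs hb].
- by apply: hl => //; rewrite -onthTE wx.
- by have [h _] := ho x (ltnW xn); apply: h.
- by have [_ h] := ho x (ltac:(by rewrite -xn)); apply: h.
have := @closure_cmdP mf2 vs s5 hvs r hr; rewrite /closed_at -/mf3.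
have atomE a : atom_fact mf3.1 vs a = atom_holds (fact mf3.1) vs a :> Prop.
  by case: a => p [[i j] k].
by rewrite -atomE; apply; apply/allP => a /hb; rewrite -atomE.
Qed.

End Word.

Theorem datalog_polytime : all rule_ok rules ->
  polytime_decidable (fun w => exists I, model w I /\
    forall x y z, x < size w -> y < size w -> z < size w -> ~ I goal x y z).
Proof.
move=> hr; have hD := fun w => datalog_cmdP w hr.
(* The nesting depth 8 is made of the three loops that count passes and the five that range over the
   variables of a rule. *)
apply: (@exec_polytime _ _ _ _ _ 8 datalog_cmd (fun f => ~~ f.2) _ _ hD).
have fits_rule r : rule_ok r -> fits 8 8 (rule_cmd r).
  have lt8 l : l < 5 -> 3 + l < 8 by lia.
  case: r => b [p [[i j] k]] /andP[hb /and3P[hi hj hk]].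
  apply/and3P; split=> //; last by rewrite /= !lt8.
  elim: b hb => //= -[q [[i' j'] k']] b IH /andP[/and3P[hi' hj' hk'] /IH ->].
  by rewrite /= !lt8.
have fits_pass : fits 8 3 pass_cmd.
  by rewrite /=; elim: rules hr => //= r rs IHr /andP[/fits_rule -> /IHr].
have fits_iter t : fits 8 3 (iter t (Seq pass_cmd) Skip).
  by elim: t => // t IH; apply/andP.
by move: (fits_iter #|P|.+1) => /= ->.
Qed.

End Datalog.

(** * Parsing *)

(* Where the reading of an encoding stands: between two quantifiers (or before
   the first atom), after [LQuant], after [LQuant] and one tick, in the first
   index of an atom, in the second one. *)
Inductive phase := Between | Quant0 | Quant1 | Index1 | Index2.

Definition nat_of_phase (q : phase) : nat :=
  match q with
  | Between => 0 | Quant0 => 1 | Quant1 => 2 | Index1 => 3 | Index2 => 4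
  end.

Definition phase_of_nat (i : nat) : option phase :=
  onth [:: Between; Quant0; Quant1; Index1; Index2] i.

Lemma nat_of_phaseK : pcancel nat_of_phase phase_of_nat.
Proof. by case. Qed.

HB.instance Definition _ := Countable.copy phase (pcan_type nat_of_phaseK).

Lemma phase_enumP : Finite.axiom [:: Between; Quant0; Quant1; Index1; Index2].
Proof. by case. Qed.

HB.instance Definition _ := isFinite.Build phase phase_enumP.

Record pstate := PState {
  ph : phase;
  nvars : nat;
  index1 : nat;
  ticks : nat;
  read : seq (nat * nat)
}.

(** Testing at every letter of an atom, and not only at the end of an index, keeps the tick count
    below the number of variables. It thus remains a position of the word and can occur in a
    fact. *)
Definition ranged (s : pstate) : option pstate :=
  if ticks s < nvars s then Some s else None.

Definition pstep (s : pstate) (a : letter) : option pstate :=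
  let: PState q m i k ats := s in
  match q, a with
  | Between, LQuant => Some (PState Quant0 m i k ats)
  | Quant0, LTick => Some (PState Quant1 m i k ats)
  | Quant1, LTick => Some (PState Between m.+1 i k ats)
  | Between, LEdge => ranged (PState Index1 m i 0 ats)
  | Index1, LTick => ranged (PState Index1 m i k.+1 ats)
  | Index1, LSep => ranged (PState Index2 m k 0 ats)
  | Index2, LTick => ranged (PState Index2 m i k.+1 ats)
  | Index2, LEdge => ranged (PState Index1 m i 0 (rcons ats (i, k)))
  | _, _ => None
  end.

Definition scan_from (o : option pstate) (w : seq letter) : option pstate :=
  foldl (fun o a => obind (pstep^~ a) o) o w.

Definition scan_word (w : seq letter) : option pstate :=
  scan_from (Some (PState Between 0 0 0 [::])) w.

Definition complete (s : pstate) : bool :=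
  match ph s with Between | Index2 => true | _ => false end.

(** The end of an atom shows only at the following letter, so in phase [Index2] the current atom is
    still pending and is added here. *)
Definition all_read (s : pstate) : seq (nat * nat) :=
  if ph s is Index2 then rcons (read s) (index1 s, ticks s) else read s.

Definition in_range (m : nat) (ats : seq (nat * nat)) :=
  all (fun a => (a.1 < m) && (a.2 < m)) ats.

Definition quants_word (m : nat) := flatten (map encode_quant (nseq m 2)).
Definition atoms_word (ats : seq (nat * nat)) := flatten (map encode_atom ats).

Definition written (s : pstate) : seq letter :=
  let: PState q m i k ats := s in
  quants_word m ++ atoms_word ats ++
  match q with
  | Between => [::]
  | Quant0 => [:: LQuant]
  | Quant1 => [:: LQuant; LTick]
  | Index1 => LEdge :: nseq k LTick
  | Index2 => encode_atom (i, k)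
  end.

Definition consistent (s : pstate) : bool :=
  let: PState q m i k ats := s in
  in_range m ats &&
  match q with
  | Between | Quant0 | Quant1 => ats == [::]
  | Index1 => k < m
  | Index2 => (i < m) && (k < m)
  end.

Lemma nseqSr T k (x : T) : nseq k.+1 x = rcons (nseq k x) x.
Proof. by elim: k => //= k ->. Qed.

Lemma quants_wordS m :
  quants_word m.+1 = quants_word m ++ [:: LQuant; LTick; LTick].
Proof. by rewrite /quants_word nseqSr map_rcons flatten_rcons. Qed.

Lemma atoms_word_rcons ats a :
  atoms_word (rcons ats a) = atoms_word ats ++ encode_atom a.
Proof. by rewrite /atoms_word map_rcons flatten_rcons. Qed.

Lemma in_range_rcons m ats a :
  in_range m (rcons ats a) = in_range m ats && ((a.1 < m) && (a.2 < m)).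
Proof. by rewrite /in_range all_rcons andbC. Qed.

Lemma ranged_Some s s' : ranged s = Some s' -> s' = s /\ ticks s < nvars s.
Proof. by rewrite /ranged; case: ifP => // h [<-]. Qed.

Lemma pstep_written s a s' : consistent s -> pstep s a = Some s' ->
  written s' = rcons (written s) a /\ consistent s'.
Proof.
case: s => q m i k ats /= /andP[hr hq].
case: q hq; case: a => //= hq;
  try (case=> <- /=); try (move=> /ranged_Some[-> /= hk]);
  rewrite -!cats1 -?catA.
- by rewrite hr hq.
- by rewrite hr hk.
- by rewrite hr hq.
- rewrite (eqP hq) -[LHS]/(quants_word m.+1 ++ [::]) quants_wordS cats0.
  by [].
- by rewrite hr hk hq.
- by rewrite hr hk -[LTick :: _]/(nseq k.+1 LTick) nseqSr -cats1.
- move/andP: hq => [hi hk']; rewrite (cats1 ats) atoms_word_rcons in_range_rcons.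
  by rewrite hr hi hk' hk -catA.
- move/andP: hq => [hi hk']; rewrite hr hi hk /encode_atom /=.
  by rewrite -[LTick :: nseq k _]/(nseq k.+1 LTick) nseqSr -cats1 -!catA.
Qed.

Lemma scan_from_None w : scan_from None w = None.
Proof. by elim: w. Qed.

Lemma scan_word_rcons w a : scan_word (rcons w a) = obind (pstep^~ a) (scan_word w).
Proof. by rewrite /scan_word /scan_from -cats1 foldl_cat. Qed.

(** The state keeps the number of quantifiers, the atoms and the unfinished item, from which the
    prefix can be rebuilt. A complete scan is therefore a decoding. *)
Lemma scan_word_written w s : scan_word w = Some s -> w = written s /\ consistent s.
Proof.
elim/last_ind: w s => [|w a IH] s; first by case=> <-.
rewrite scan_word_rcons; case: scan_word IH => //= s0 /(_ _ erefl)[-> hc].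
by case/(pstep_written hc) => ->.
Qed.

Lemma scan_word_decodes w s : scan_word w = Some s -> complete s ->
  let phi := Sentence (nseq (nvars s) 2) (all_read s) in
  w = encode phi /\ X_sentence (pred1 2) phi.
Proof.
move=> /scan_word_written[-> hc] hq.
rewrite /encode /X_sentence /= all_nseq /= orbT size_nseq -/(in_range _ _).
case: s hc hq => -[] m i k ats //= /andP[hr hq] _; rewrite /all_read /=.
  by rewrite cats0.
rewrite -[flatten (map encode_atom _)]/(atoms_word _) atoms_word_rcons.
by rewrite in_range_rcons hr hq.
Qed.

Lemma scan_from_cat o u v : scan_from o (u ++ v) = scan_from (scan_from o u) v.
Proof. exact: foldl_cat. Qed.

Lemma scan_quants m m' i k ats :
  scan_from (Some (PState Between m' i k ats)) (quants_word m) =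
  Some (PState Between (m' + m) i k ats).
Proof.
elim: m m' => [|m IH] m'; first by rewrite addn0.
by rewrite -addSnnS -IH.
Qed.

Lemma scan_ticks1 m i k ats d : k + d < m ->
  scan_from (Some (PState Index1 m i k ats)) (nseq d LTick) =
  Some (PState Index1 m i (k + d) ats).
Proof.
elim: d k => [|d IH] k h; first by rewrite addn0.
by rewrite -addSnnS in h *; rewrite -IH //= /ranged /= ifT //; lia.
Qed.

Lemma scan_ticks2 m i k ats d : k + d < m ->
  scan_from (Some (PState Index2 m i k ats)) (nseq d LTick) =
  Some (PState Index2 m i (k + d) ats).
Proof.
elim: d k => [|d IH] k h; first by rewrite addn0.
by rewrite -addSnnS in h *; rewrite -IH //= /ranged /= ifT //; lia.
Qed.

Lemma scan_atom s a : complete s -> a.1 < nvars s -> a.2 < nvars s ->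
  scan_from (Some s) (encode_atom a) =
  Some (PState Index2 (nvars s) a.1 a.2 (all_read s)).
Proof.
case: a => a b hc /= ha hb; have m0 : 0 < nvars s by lia.
have -> : pstep s LEdge = Some (PState Index1 (nvars s) (index1 s) 0 (all_read s)).
  by case: s hc m0 {ha hb} => -[] m i k ats //= _ m0; rewrite /ranged m0.
rewrite -/(scan_from _ _) scan_from_cat scan_ticks1 //= /ranged /= m0.
by rewrite -/(scan_from _ _) scan_ticks2.
Qed.

Lemma scan_atoms s ats : complete s -> in_range (nvars s) ats ->
  exists s', [/\ scan_from (Some s) (atoms_word ats) = Some s', complete s',
    nvars s' = nvars s & all_read s' = all_read s ++ ats].
Proof.
elim: ats s => [|a ats IH] s hc; first by exists s; rewrite cats0.
move=> /andP[/andP[h1 h2] hr].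
rewrite -[atoms_word _]/(encode_atom a ++ atoms_word ats).
rewrite scan_from_cat scan_atom //.
have [s' [e c n r]] := IH (PState Index2 (nvars s) a.1 a.2 (all_read s)) isT hr.
by exists s'; split=> //; rewrite r /all_read /= cat_rcons; case: (a).
Qed.

Lemma scan_word_encode phi : X_sentence (pred1 2) phi ->
  exists s, [/\ scan_word (encode phi) = Some s, complete s,
    quants phi = nseq (nvars s) 2 & all_read s = atoms phi].
Proof.
case: phi => qs ats /andP[/all_pred1P /= eq hr].
have := @scan_atoms (PState Between (size qs) 0 0 [::]) ats isT hr.
move=> [s [e c n r]]; exists s; split=> //; last by rewrite n.
rewrite /encode /= [in LHS]eq -/(quants_word _) -/(atoms_word _).
by rewrite /scan_word scan_from_cat scan_quants add0n.
Qed.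

(** Each quantifier takes three letters. Hence variables, and even their number, can be represented
    by positions of the word. *)
Lemma nvars_lt w s : scan_word w = Some s -> 0 < size w -> nvars s < size w.
Proof.
move=> /scan_word_written[-> _]; case: s => q m i k ats.
have sq : size (quants_word m) = m * 3.
  by elim: m => //= m; rewrite /quants_word /= => ->.
by rewrite /written size_cat sq /=; lia.
Qed.

Lemma scan_from_read s w s' : scan_from (Some s) w = Some s' ->
  {subset read s <= read s'}.
Proof.
elim: w s => [|a w IH] s /=; first by case=> ->.
rewrite -/(scan_from _ _); case e: (pstep s a) => [s1|]; last first.
  by rewrite scan_from_None.
move=> /IH h x hx; apply: h.
case: s hx e => -[] m i k ats /= hx; case: a => //; rewrite /ranged /=;
  try (case: ifP => // _); case=> <- //=.
by rewrite mem_rcons inE hx orbT.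
Qed.

(** * The colouring game *)

Lemma pigeonhole4 (a b c d e : 'I_4) : uniq [:: a; b; c; d; e] = false.
Proof.
apply/negP => /card_uniqP /= h; have := max_card [in [:: a; b; c; d; e]].
by rewrite h card_ord.
Qed.

Ltac colours := rewrite /= ?inE /= ?negb_or; repeat (match goal with
  | |- context [@eq_op _ ?a ?b] =>
    let h := fresh in case: (@eqP _ a b) => h /=; try done; try congruence
  end); try done; try congruence.

(** * Constraints that hold in every play *)

Section Game.
Variables (m : nat) (ats : seq (nat * nat)).

Definition wins (env : seq 'I_4) := eval (K 4) ats env (nseq (m - size env) 2).

Lemma wins_lt env : size env < m ->
  wins env = (1 < #|[set c | wins (rcons env c)]|).
Proof.
move=> h; rewrite /wins -subnSK //=.
by congr (_ < #|pred_of_set _|); apply/setP => c; rewrite !inE size_rcons.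
Qed.

(* The positions that can occur when Prover plays winning moves only. *)
Definition good (env : seq 'I_4) :=
  size env <= m /\ forall k, k <= size env -> wins (take k env).

Definition col (env : seq 'I_4) (x : nat) : 'I_4 := nth ord0 env x.

Lemma good_take k env : good env -> good (take k env).
Proof.
move=> [hm h]; split=> [|j hj].
  by rewrite size_take; case: ifP => // /ltnW/leq_trans; apply.
have jk : j <= k by move: hj; rewrite size_take; case: ifP; lia.
by rewrite take_takel //; apply: h; move: hj; rewrite size_take; case: ifP; lia.
Qed.

Lemma good_step env : good env -> size env < m ->
  exists c1 c2, [/\ c1 != c2, good (rcons env c1) & good (rcons env c2)].
Proof.
move=> [hm h] hlt; have := h _ (leqnn _); rewrite take_size wins_lt //.
case/card_gt1P => c1 [c2 []]; rewrite !inE => h1 h2 hc.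
have hg c : wins (rcons env c) -> good (rcons env c).
  move=> hw; split=> [|k]; rewrite size_rcons // leq_eqVlt => /orP[/eqP->|hk].
    by rewrite take_oversize // size_rcons.
  by rewrite -cats1 takel_cat //; apply: h.
by exists c1, c2; split=> //; apply: hg.
Qed.

Lemma good_extend env z : good env -> size env <= z <= m ->
  exists2 e, good (env ++ e) & size (env ++ e) = z.
Proof.
move=> hg; elim: z => [|z IH] hz; first by exists [::]; rewrite cats0 //; lia.
case: (ltngtP (size env) z.+1) => [hlt||e]; [|lia|by exists [::]; rewrite cats0].
have [e he hs] := IH ltac:(lia).
have [|c [_ [_ h1 _]]] := good_step he; first by rewrite hs; lia.
exists (rcons e c); first by rewrite -rcons_cat.
by rewrite -rcons_cat size_rcons hs.
Qed.

Definition play (env : seq 'I_4) := good env /\ size env = m.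

(** This is Opponent's power in usable form. At a winning position with [z] to be coloured there are
    two winning colours, and each of them extends to a complete play; nothing is said about the
    variables after [z]. *)
Lemma play_branch env z : play env -> z < m ->
  exists e1 e2, [/\ play e1, play e2,
    forall u, u < z -> col e1 u = col env u,
    forall u, u < z -> col e2 u = col env u & col e1 z != col e2 z].
Proof.
move=> [hg hs] hz; have st : size (take z env) = z by rewrite size_takel ?hs 1?ltnW.
have [|c1 [c2 [hc g1 g2]]] := good_step (good_take z hg); first by rewrite st.
have ext c : good (rcons (take z env) c) ->
    exists e, [/\ play e, forall u, u < z -> col e u = col env u & col e z = c].
  move=> /good_extend -/(_ m)[|e he se]; first by rewrite size_rcons st hz leqnn.
  exists (rcons (take z env) c ++ e); split=> // [u uz|].
    by rewrite /col nth_cat size_rcons st ltnS (ltnW uz) nth_rcons st uz nth_take.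
  by rewrite /col nth_cat size_rcons st ltnSn nth_rcons st ltnn eqxx.
have [e1 [p1 a1 b1]] := ext _ g1; have [e2 [p2 a2 b2]] := ext _ g2.
by exists e1, e2; split=> //; rewrite b1 b2.
Qed.

(** The three constraint forms, read over all plays that consist of winning moves. Since all plays
    are covered, a rule can be checked on one play and its two branches. *)
Definition dsure x y := [/\ x < m, y < m & forall env, play env ->
  col env x != col env y].

Definition nsure x y z := [/\ x < m, y < m, z < m & forall env, play env ->
  [|| col env x == col env y, col env x == col env z | col env y == col env z]].

Definition msure x y z := [/\ x < m, y < m, z < m & forall env, play env ->
  (col env x != col env y) ==>
  (col env z != col env x) && (col env z != col env y)].

Lemma dsure_sym x y : dsure x y -> dsure y x.
Proof. by move=> [hx hy h]; split=> // env hp; rewrite eq_sym h. Qed.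

Lemma nsure_swap x y z : nsure x y z -> nsure y x z.
Proof. by move=> [hx hy hz h]; split=> // env hp; move: (h env hp); colours. Qed.

Lemma nsure_rot x y z : nsure x y z -> nsure y z x.
Proof. by move=> [hx hy hz h]; split=> // env hp; move: (h env hp); colours. Qed.

Lemma msure_swap x y z : msure x y z -> msure y x z.
Proof. by move=> [hx hy hz h]; split=> // env hp; move: (h env hp); colours. Qed.

Lemma dsure_dsure x y z : dsure x z -> dsure y z -> msure x y z.
Proof.
move=> [hx hz h1] [hy _ h2]; split=> // env hp.
by move: (h1 _ hp) (h2 _ hp); colours.
Qed.

Local Ltac before c1 c2 vs :=
  match vs with
  | (?us, ?u) => before c1 c2 us; before c1 c2 u
  | ?u => rewrite ?(c1 u) ?(c2 u); [|by lia ..]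
  end.

(** Otherwise three different colours of [x], [y], [w], together with the two that [z] takes in the
    branches, would make five. *)
Lemma msure_dsure_nsure x y z w : x < y < z -> w < z ->
  msure x y z -> dsure w z -> nsure x y w.
Proof.
move=> xyz wz [hx hy hz h1] [hw _ h2]; split=> // env hp.
have [e1 [e2 [p1 p2 c1 c2 hc]]] := play_branch hp hz.
move: (h1 _ p1) (h1 _ p2) (h2 _ p1) (h2 _ p2) hc; before c1 c2 (x, y, w).
have := pigeonhole4 (col env x) (col env y) (col env w) (col e1 z) (col e2 z).
by colours.
Qed.

(** If [x] and [y] differ, the two branches give [z] both of their colours, and [w] must differ from
    [z] in each branch. *)
Lemma nsure_dsure_msure x y z w : x < y < z -> w < z ->
  nsure x y z -> dsure w z -> msure x y w.
Proof.
move=> xyz wz [hx hy hz h1] [hw _ h2]; split=> // env hp.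
have [e1 [e2 [p1 p2 c1 c2 hc]]] := play_branch hp hz.
move: (h1 _ p1) (h1 _ p2) (h2 _ p1) (h2 _ p2) hc; before c1 c2 (x, y, w).
by colours.
Qed.

(** Opponent can make [y] differ from [x] after both [x] and [w] are coloured, so [w] always differs
    from [x]. When [x] and [y] agree, this also separates [w] from [y]. *)
Lemma msure_low x y w : x < y -> w < y -> msure x y w -> dsure x w /\ dsure y w.
Proof.
move=> xy wy [hx hy hw h]; have d1 : dsure x w.
  split=> // env hp; have [e1 [e2 [p1 p2 c1 c2 hc]]] := play_branch hp hy.
  by move: (h _ p1) (h _ p2) hc; before c1 c2 (x, w); colours.
split=> //; split=> // env hp; have [_ _ /(_ _ hp)] := d1.
by move: (h _ hp); colours.
Qed.

(** An intermediate form on four variables, obtained by eliminating [z]; inclusion of the pairs is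
    equality, since both have two colours. It is brought back to three variables in
    [same_pair_nsure]. *)
Definition same_pair x y x' y' := [/\ x < m, y < m, x' < m, y' < m &
  forall env, play env ->
  (col env x != col env y) ==> (col env x' != col env y') ==>
  (col env x' \in [:: col env x; col env y]) &&
  (col env y' \in [:: col env x; col env y])].

Definition disjoint_pair x y x' y' := [/\ x < m, y < m, x' < m, y' < m &
  forall env, play env ->
  (col env x != col env y) ==> (col env x' != col env y') ==>
  (col env x' \notin [:: col env x; col env y]) &&
  (col env y' \notin [:: col env x; col env y])].

Lemma nsure_same_pair x y x' y' z : x < y < z -> x' < y' < z ->
  nsure x y z -> nsure x' y' z -> same_pair x y x' y'.
Proof.
move=> xyz xyz' [hx hy hz h1] [hx' hy' _ h2]; split=> // env hp.
have [e1 [e2 [p1 p2 c1 c2 hc]]] := play_branch hp hz.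
move: (h1 _ p1) (h1 _ p2) (h2 _ p1) (h2 _ p2) hc; before c1 c2 (x, y, x', y').
by colours.
Qed.

(** Both pairs are the complement of the two colours of [z], which is where the number four
    enters. *)
Lemma msure_same_pair x y x' y' z : x < y < z -> x' < y' < z ->
  msure x y z -> msure x' y' z -> same_pair x y x' y'.
Proof.
move=> xyz xyz' [hx hy hz h1] [hx' hy' _ h2]; split=> // env hp.
have [e1 [e2 [p1 p2 c1 c2 hc]]] := play_branch hp hz.
move: (h1 _ p1) (h1 _ p2) (h2 _ p1) (h2 _ p2) hc; before c1 c2 (x, y, x', y').
have := pigeonhole4 (col env x) (col env y) (col env x') (col e1 z) (col e2 z).
have := pigeonhole4 (col env x) (col env y) (col env y') (col e1 z) (col e2 z).
by colours.
Qed.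

Lemma nsure_msure_disjoint x y x' y' z : x < y < z -> x' < y' < z ->
  nsure x y z -> msure x' y' z -> disjoint_pair x y x' y'.
Proof.
move=> xyz xyz' [hx hy hz h1] [hx' hy' _ h2]; split=> // env hp.
have [e1 [e2 [p1 p2 c1 c2 hc]]] := play_branch hp hz.
move: (h1 _ p1) (h1 _ p2) (h2 _ p1) (h2 _ p2) hc; before c1 c2 (x, y, x', y').
by colours.
Qed.

Lemma disjoint_pair_sym x y x' y' :
  disjoint_pair x y x' y' -> disjoint_pair x' y' x y.
Proof.
move=> [hx hy hx' hy' h]; split=> // env hp.
by move: (h _ hp); colours.
Qed.

(** Branching at [y'] leaves [x], [y], [x'] alone and in one branch separates [y'] from [x'], so the
    condition on the second pair is dropped for [x']. For [y'] itself, either it differs from [x']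
    and the hypothesis applies, or it shares its colour. *)
Lemma same_pair_nsure x y x' y' : x < y -> x' < y' -> y <= y' ->
  same_pair x y x' y' -> nsure x y x' /\ nsure x y y'.
Proof.
move=> xy xy' yy [hx hy hx' hy' h].
move: yy; rewrite leq_eqVlt => /orP[/eqP e|yy].
  by rewrite -e in h *; split; split=> // env hp; move: (h _ hp); colours.
have n1 : nsure x y x'.
  split=> // env hp; have [e1 [e2 [p1 p2 c1 c2 hc]]] := play_branch hp hy'.
  by move: (h _ p1) (h _ p2) hc; before c1 c2 (x, y, x'); colours.
split=> //; split=> // env hp; have [_ _ _ /(_ _ hp)] := n1.
by move: (h _ hp); colours.
Qed.

(** The same elimination of the condition on the later pair. The strict order matters: with [y = y']
    the pairs cannot be disjoint. *)
Lemma disjoint_pair_msure x y x' y' : x < y -> x' < y' -> y < y' ->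
  disjoint_pair x y x' y' -> msure x y x' /\ msure x y y'.
Proof.
move=> xy xy' yy [hx hy hx' hy' h].
have n1 : msure x y x'.
  split=> // env hp; have [e1 [e2 [p1 p2 c1 c2 hc]]] := play_branch hp hy'.
  by move: (h _ p1) (h _ p2) hc; before c1 c2 (x, y, x'); colours.
split=> //; split=> // env hp; have [_ _ _ /(_ _ hp)] := n1.
by move: (h _ hp); colours.
Qed.

(** Pairs that share [y] are never disjoint, so one of them is monochromatic: [y] has the colour of
    [x] or of [x']. As [y] takes two colours over the branches, [x] and [x'] differ. *)
Lemma disjoint_pair_same_top x x' y : x < y -> x' < y ->
  disjoint_pair x y x' y -> dsure x x' /\ nsure x x' y.
Proof.
move=> xy xy' [hx hy hx' _ h].
split; split=> // env hp; last by move: (h _ hp); colours.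
have [e1 [e2 [p1 p2 c1 c2 hc]]] := play_branch hp hy.
by move: (h _ p1) (h _ p2) hc; before c1 c2 (x, x'); colours.
Qed.

Hypothesis start_wins : wins [::].

Lemma play0 : exists env, play env.
Proof.
have g0 : good [::] by split=> // -[].
by have [|e he se] := @good_extend [::] m g0; [rewrite leqnn|exists e].
Qed.

Lemma dsure_irrefl x : ~ dsure x x.
Proof. by case=> hx _ h; have [env /h] := play0; rewrite eqxx. Qed.

Lemma msure_irrefl x y : x < y -> ~ msure x y y.
Proof.
move=> xy [hx hy _ h]; have [env hp] := play0.
have [e1 [e2 [p1 p2 c1 c2 hc]]] := play_branch hp hy.
by move: (h _ p1) (h _ p2) hc; before c1 c2 x; colours.
Qed.

End Game.

Lemma two_others (a b : 'I_4) : exists c c' : 'I_4,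
  [/\ c != c', c \notin [:: a; b] & c' \notin [:: a; b]].
Proof.
have : 1 < #|~: [set a; b]|.
  have := cardsC [set a; b]; rewrite card_ord cards2 => h.
  by have := leq_b1 (a != b); lia.
case/card_gt1P => c [c' []]; rewrite !in_setC !in_set2 => h h' hc.
by exists c, c'; rewrite !inE.
Qed.

(** * Prover's strategy from a closed set of constraints *)

Section Closed.
Variables (m : nat) (ats : seq (nat * nat)).
Variables (D : nat -> nat -> Prop) (N M : nat -> nat -> nat -> Prop).

(* [D x y]: different colours; [N x y z]: at most two colours; [M x y z]: z
   avoids the colours of x and y whenever these differ. The fields with two
   constraints on z express what they say about the earlier variables, using
   that Opponent can make a later variable differ from an earlier one. *)
Record closed_facts : Prop := ClosedFacts {
  cf_D_sym : forall x y, x < m -> y < m -> D x y -> D y x;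
  cf_N_swap : forall x y z, x < m -> y < m -> z < m -> N x y z -> N y x z;
  cf_N_rot : forall x y z, x < m -> y < m -> z < m -> N x y z -> N y z x;
  cf_M_swap : forall x y z, x < m -> y < m -> z < m -> M x y z -> M y x z;
  cf_DD : forall x y z, x < m -> y < m -> z < m -> D x z -> D y z -> M x y z;
  cf_D_irrefl : forall x, x < m -> ~ D x x;
  cf_M_irrefl : forall x y, x < y -> y < m -> ~ M x y y;
  cf_M_low : forall x y w, x < y -> w < y -> y < m -> M x y w -> D x w /\ D y w;
  cf_MD : forall x y z w, x < y < z -> w < z -> z < m ->
    M x y z -> D w z -> N x y w;
  cf_ND : forall x y z w, x < y < z -> w < z -> z < m ->
    N x y z -> D w z -> M x y w;
  cf_NN : forall x y x' y' z, x < y < z -> x' < y' < z -> y <= y' -> z < m ->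
    N x y z -> N x' y' z -> N x y x' /\ N x y y';
  cf_MM : forall x y x' y' z, x < y < z -> x' < y' < z -> y <= y' -> z < m ->
    M x y z -> M x' y' z -> N x y x' /\ N x y y';
  cf_NM : forall x y x' y' z, x < y < z -> x' < y' < z -> y < y' -> z < m ->
    N x y z -> M x' y' z -> M x y x' /\ M x y y';
  cf_MN : forall x y x' y' z, x < y < z -> x' < y' < z -> y < y' -> z < m ->
    M x y z -> N x' y' z -> M x y x' /\ M x y y';
  cf_NM_top : forall x x' y z, x < y < z -> x' < y -> z < m ->
    N x y z -> M x' y z -> D x x' /\ N x x' y
}.

Hypothesis cf : closed_facts.

Definition nad (a b c : 'I_4) := [|| a == b, a == c | b == c].
Definition avoids (a b c : 'I_4) := (a != b) ==> (c != a) && (c != b).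

(* Prover can always keep this invariant. *)
Definition respected k (c : nat -> 'I_4) := [/\
  forall x y, x < k -> y < k -> D x y -> c x != c y,
  forall x y z, x < k -> y < k -> z < k -> N x y z -> nad (c x) (c y) (c z) &
  forall x y z, x < k -> y < k -> z < k -> M x y z -> avoids (c x) (c y) (c z)].

Definition allowed k (c : nat -> 'I_4) (a : 'I_4) := [/\
  forall w, w < k -> D w k -> c w != a,
  forall x y, x < y < k -> N x y k -> nad (c x) (c y) a &
  forall x y, x < y < k -> M x y k -> avoids (c x) (c y) a].

(** Prover has to watch only the constraints whose last variable is constrained by an ordered
    earlier pair. Symmetry sorts the rest, and an [M] whose target lies below the top of its pair
    splits into two [D]. *)
Lemma respected_next k c : k < m -> respected k c -> allowed k c (c k) ->
  respected k.+1 c.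
Proof.
move=> km [hD hN hM] [aD aN aM].
have rD x y : x < k.+1 -> y < k.+1 -> D x y -> c x != c y.
  rewrite !ltnS [x <= k]leq_eqVlt [y <= k]leq_eqVlt.
  case/orP => [/eqP->|xk] /orP[/eqP->|yk] d; try by [exact: hD|exact: aD].
    by have := cf_D_irrefl cf km d.
  by rewrite eq_sym; apply: aD => //; apply: (cf_D_sym cf _ _ d); lia.
have sN x y z : x < y < z -> z < k.+1 -> N x y z -> nad (c x) (c y) (c z).
  move=> xyz; rewrite ltnS leq_eqVlt => /orP[/eqP e|zk].
    by rewrite e in xyz *; apply: aN.
  by apply: hN; lia.
have sM x y z : x < y -> y < k.+1 -> z < k.+1 -> M x y z ->
    avoids (c x) (c y) (c z).
  move=> xy yk zk h; case: (ltngtP z y) => [zy|yz|e].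
  - have [] := cf_M_low cf xy zy _ h; first by lia.
    move=> /(rD x z)-/(_ ltac:(lia) zk) d1 /(rD y z yk zk).
    by move: d1; rewrite /avoids; colours.
  - move: zk h; rewrite ltnS leq_eqVlt => /orP[/eqP e|zk] h.
      rewrite e in yz h *.
      by apply: aM => //; lia.
    by apply: hM => //; lia.
  - by rewrite e in h; case: (cf_M_irrefl cf xy _ h); lia.
split=> // x y z xk yk zk h.
- have swp a b d : nad a b d = nad b a d by rewrite /nad; colours.
  have rot a b d : nad a b d = nad b d a by rewrite /nad; colours.
  have [xm ym zm] : [/\ x < m, y < m & z < m] by split; lia.
  have r1 := cf_N_rot cf xm ym zm h; have r2 := cf_N_rot cf ym zm xm r1.
  have s0 := cf_N_swap cf xm ym zm h; have s1 := cf_N_swap cf ym zm xm r1.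
  have s2 := cf_N_swap cf zm xm ym r2.
  case: (ltngtP x y) => [xy|xy|->]; last by rewrite /nad eqxx.
    case: (ltngtP y z) => [yz|yz|->]; last by rewrite /nad eqxx !orbT.
      by apply: sN => //; lia.
    case: (ltngtP x z) => [xz|xz|->]; last by rewrite /nad eqxx !orbT.
      by rewrite rot rot swp; apply: sN => //; lia.
    by rewrite rot rot; apply: sN => //; lia.
  case: (ltngtP x z) => [xz|xz|->]; last by rewrite /nad eqxx !orbT.
    by rewrite swp; apply: sN => //; lia.
  case: (ltngtP y z) => [yz|yz|->]; last by rewrite /nad eqxx !orbT.
    by rewrite rot; apply: sN => //; lia.
  by rewrite rot swp; apply: sN => //; lia.
have [xm ym zm] : [/\ x < m, y < m & z < m] by split; lia.
have s0 := cf_M_swap cf xm ym zm h.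
case: (ltngtP x y) => [xy|xy|->]; last by rewrite /avoids eqxx.
  exact: sM.
by move: (sM _ _ _ xy xk zk s0); rewrite /avoids; colours.
Qed.

(** The answer is only classical because [D], [N] and [M] are arbitrary predicates, and whether some
    constraint on [k] is active need not be decidable. *)
Lemma two_allowed k c : k < m -> respected k c ->
  classically (exists a b, [/\ a != b, allowed k c a & allowed k c b]).
Proof.
move=> km [hD hN hM].
(* An active [N] dictates the pair [c x], [c y]; the closure rules then show that every other
   constraint on [k] accepts these two colours. *)
apply: classic_bind (@classic_EM
  (exists x y, [/\ x < y < k, N x y k & c x != c y])) => -[|noN].
  case=> x [y [xyk nxy cxy]].
  suff ok a : a \in [:: c x; c y] -> allowed k c a.
    apply/classicW; exists (c x), (c y).
    by split=> //; apply: ok; rewrite !inE eqxx ?orbT.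
  move=> ha; split=> [w wk d|x' y' xyk' n'|x' y' xyk' m'].
  - have := hM x y w; move/(_ _ _ wk (cf_ND cf xyk wk km nxy d)).
    move=> /(_ ltac:(lia) ltac:(lia)).
    by move: ha cxy; rewrite /avoids; colours.
  - case: (leqP y y') => yy.
      have [n1 n2] := cf_NN cf xyk xyk' yy km nxy n'.
      have := hN x y x' ltac:(lia) ltac:(lia) ltac:(lia) n1.
      have := hN x y y' ltac:(lia) ltac:(lia) ltac:(lia) n2.
      by move: ha cxy; rewrite /nad; colours.
    have [n1 n2] := cf_NN cf xyk' xyk (ltnW yy) km n' nxy.
    have := hN x' y' x ltac:(lia) ltac:(lia) ltac:(lia) n1.
    have := hN x' y' y ltac:(lia) ltac:(lia) ltac:(lia) n2.
    by move: ha cxy; rewrite /nad; colours.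
  - case: (ltngtP y y') => yy.
    + have [n1 n2] := cf_NM cf xyk xyk' yy km nxy m'.
      have := hM x y x' ltac:(lia) ltac:(lia) ltac:(lia) n1.
      have := hM x y y' ltac:(lia) ltac:(lia) ltac:(lia) n2.
      by move: ha cxy; rewrite /avoids; colours.
    + have [n1 n2] := cf_MN cf xyk' xyk yy km m' nxy.
      have := hM x' y' x ltac:(lia) ltac:(lia) ltac:(lia) n1.
      have := hM x' y' y ltac:(lia) ltac:(lia) ltac:(lia) n2.
      by move: ha cxy; rewrite /avoids; colours.
    + rewrite -yy in xyk' m' *.
      have x'y : x' < y by lia.
      have [n1 n2] := cf_NM_top cf xyk x'y km nxy m'.
      have := hN x x' y ltac:(lia) ltac:(lia) ltac:(lia) n2.
      have := hD x x' ltac:(lia) ltac:(lia) n1.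
      by move: ha cxy; rewrite /nad /avoids; colours.
have idleN x y a : x < y < k -> N x y k -> nad (c x) (c y) a.
  move=> xyk n; rewrite /nad; case: eqP => //= /eqP h.
  by case: noN; exists x, y.
(* No [N] is active any more. An active [M] dictates the two colours other than [c x] and [c y]. *)
apply: classic_bind (@classic_EM
  (exists x y, [/\ x < y < k, M x y k & c x != c y])) => -[|noM].
  case=> x [y [xyk mxy cxy]].
  have [a [b [hab ha hb]]] := two_others (c x) (c y).
  suff ok a' : a' \notin [:: c x; c y] -> allowed k c a'.
    by apply/classicW; exists a, b; split=> //; apply: ok.
  move=> {}ha; split=> [w wk d|x' y' xyk' n'|x' y' xyk' m']; last 2 first.
  - exact: idleN.
  - case: (leqP y y') => yy.
      have [n1 n2] := cf_MM cf xyk xyk' yy km mxy m'.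
      have := hN x y x' ltac:(lia) ltac:(lia) ltac:(lia) n1.
      have := hN x y y' ltac:(lia) ltac:(lia) ltac:(lia) n2.
      by move: ha cxy; rewrite /nad /avoids; colours.
    have [n1 n2] := cf_MM cf xyk' xyk (ltnW yy) km m' mxy.
    have := hN x' y' x ltac:(lia) ltac:(lia) ltac:(lia) n1.
    have := hN x' y' y ltac:(lia) ltac:(lia) ltac:(lia) n2.
    by move: ha cxy; rewrite /nad /avoids; colours.
  - have := hN x y w ltac:(lia) ltac:(lia) wk (cf_MD cf xyk wk km mxy d).
    by move: ha cxy; rewrite /nad; colours.
have idleM x y : x < k -> y < k -> M x y k -> c x = c y.
  move=> xk yk mxy; apply/eqP/negP => /negP cxy.
  case: (ltngtP x y) => [xy|xy|e]; last by rewrite e eqxx in cxy.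
    by case: noM; exists x, y; rewrite xy.
  case: noM; exists y, x; rewrite xy eq_sym; split=> //.
  by apply: (cf_M_swap cf _ _ _ mxy); lia.
have fin e : (forall w, w < k -> D w k -> c w = e) ->
    exists a b, [/\ a != b, allowed k c a & allowed k c b].
  move=> he; have [a [b [hab ha hb]]] := two_others e e.
  suff ok a' : a' \notin [:: e; e] -> allowed k c a'.
    by exists a, b; split=> //; apply: ok.
  move=> {}ha; split=> [w wk d|x' y' xyk' n'|x' y' xyk' m'].
  - by rewrite he //; move: ha; colours.
  - exact: idleN.
  - by rewrite /avoids (idleM x' y') ?eqxx //; lia.
(* With no active [N] or [M], the rule [cf_DD] forces all earlier [D]-neighbours of [k] to share one
   colour, and any two further colours will do. *)
apply: classic_bind (@classic_EM (exists2 w, w < k & D w k)) => -[[w wk d]|noD].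
  apply/classicW/(fin (c w)) => w' w'k d'.
  by apply: idleM => //; apply: (cf_DD cf _ _ _ d' d); lia.
by apply/classicW/(fin ord0) => w wk d; case: noD; exists w.
Qed.

Hypothesis ats_D : forall a, a \in ats -> [/\ a.1 < m, a.2 < m & D a.1 a.2].

Lemma respected_wins env : size env <= m -> respected (size env) (col env) ->
  wins m ats env.
Proof.
move: {2}(m - _) (erefl (m - size env)) => d.
elim: d env => [|d IH] env hd hm hr.
  rewrite /wins hd /=; apply/allP => a /ats_D[h1 h2 hD].
  have se : size env = m by lia.
  rewrite /atom_true; have := onthTE env a.1; have := onthTE env a.2.
  rewrite se h1 h2; case e2: (onth env a.2) => [v|] //.
  case e1: (onth env a.1) => [u|] // _ _.
  have [hr1 _ _] := hr; rewrite /K.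
  have := hr1 a.1 a.2.
  by rewrite /col (onth_nth _ _ _ _ e1) (onth_nth _ _ _ _ e2) se; apply.
rewrite wins_lt; last by lia.
have km : size env < m by lia.
(* The goal is a boolean, so the classical existence may be opened here. *)
apply: (two_allowed km hr) => -[a [b [hab ha hb]]].
have ok a' : allowed (size env) (col env) a' -> wins m ats (rcons env a').
  move=> h; apply: IH; rewrite ?size_rcons //; first by lia.
  have e u : u < size env -> col (rcons env a') u = col env u.
    by move=> hu; rewrite /col nth_rcons hu.
  have e' : col (rcons env a') (size env) = a' by rewrite /col nth_rcons ltnn eqxx.
  apply: respected_next => //.
    have [h1 h2 h3] := hr.
    by split=> [x y xk yk|x y z xk yk zk|x y z xk yk zk]; rewrite !e //;
      [apply: h1|apply: h2|apply: h3].
  have [h1 h2 h3] := h; rewrite /allowed e'.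
  split=> [x xk|x y xyk|x y xyk]; rewrite !e //; try lia;
    [exact: h1|exact: h2|exact: h3].
by apply/card_gt1P; exists a, b; rewrite !inE !ok.
Qed.

Theorem closed_facts_wins : wins m ats [::].
Proof. by apply: respected_wins => //; split. Qed.

End Closed.

(** * The Datalog program *)

Lemma atoms_dsure m ats a : in_range m ats -> a \in ats -> dsure m ats a.1 a.2.
Proof.
move=> /allP hr ha; have /andP[h1 h2] := hr _ ha.
split=> // env [[hs hw] se]; have := hw _ (leqnn _).
rewrite take_size /wins se subnn /= => /allP/(_ _ ha); rewrite /atom_true.
case e1: (onth env a.1) => [u|] //; case e2: (onth env a.2) => [v|] //.
by rewrite /col (onth_nth _ _ _ _ e1) (onth_nth _ _ _ _ e2).
Qed.

(** [Vars], [Ticks] and [Index] relate a position to the counters of the parser after that position,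
    the value of a counter being represented by a position too. *)
Inductive symbol :=
  Succ | First | Last | Fail | Vars | Ticks | Index | Lt | Le | Differ | Nad |
  Avoid.

Definition nat_of_symbol (p : symbol) : nat :=
  match p with
  | Succ => 0 | First => 1 | Last => 2 | Fail => 3 | Vars => 4 | Ticks => 5
  | Index => 6 | Lt => 7 | Le => 8 | Differ => 9 | Nad => 10 | Avoid => 11
  end.

Definition symbols :=
  [:: Succ; First; Last; Fail; Vars; Ticks; Index; Lt; Le; Differ; Nad; Avoid].

Lemma nat_of_symbolK : pcancel nat_of_symbol (onth symbols).
Proof. by case. Qed.

HB.instance Definition _ := Countable.copy symbol (pcan_type nat_of_symbolK).

Lemma symbol_enumP : Finite.axiom symbols.
Proof. by case. Qed.

HB.instance Definition _ := isFinite.Build symbol symbol_enumP.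

Definition pred_name : finType := (letter + (phase + symbol))%type.

Definition of_letter (a : letter) : pred_name := inl a.
Definition of_phase (q : phase) : pred_name := inr (inl q).
Definition of_symbol (p : symbol) : pred_name := inr (inr p).

Definition rd a i : atom pred_name := (of_letter a, (i, i, i)).
Definition in_phase q i : atom pred_name := (of_phase q, (i, i, i)).
Definition un p i : atom pred_name := (of_symbol p, (i, i, i)).
Definition bi p i j : atom pred_name := (of_symbol p, (i, j, j)).
Definition ter p i j k : atom pred_name := (of_symbol p, (i, j, k)).

(* Variables 0 and 1 are consecutive positions of the input. *)
Definition trans_rules (q : phase) (a : letter) : seq (rule pred_name) :=
  let pre := [:: in_phase q 0; bi Succ 0 1; rd a 1] in
  let go q' := (pre, in_phase q' 1) in
  let keep := (bi Vars 0 2 :: pre, bi Vars 1 2) in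
  let zero := (un First 2 :: pre, bi Ticks 1 2) in
  let incr := (bi Ticks 0 2 :: bi Succ 2 3 :: pre, bi Ticks 1 3) in
  match q, a with
  | Between, LQuant => [:: go Quant0; keep]
  | Quant0, LTick => [:: go Quant1; keep]
  | Quant1, LTick => [:: go Between;
      (bi Vars 0 2 :: bi Succ 2 3 :: pre, bi Vars 1 3)]
  | Between, LEdge => [:: go Index1; keep; zero]
  | Index1, LTick => [:: go Index1; keep; incr]
  | Index1, LSep => [:: go Index2; keep; zero;
      (bi Ticks 0 2 :: pre, bi Index 1 2)]
  | Index2, LTick => [:: go Index2; keep; incr;
      (bi Index 0 2 :: pre, bi Index 1 2)]
  | Index2, LEdge => [:: go Index1; keep; zero;
      (bi Index 0 2 :: bi Ticks 0 3 :: pre, bi Differ 2 3)]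
  | _, _ => [:: (pre, un Fail 0)]
  end.

(** The initial state belongs to no position, so the first letter has rules of its own; an atom
    there is out of range for lack of variables. The last rule tests only equality, since a tick
    count rises by one at a time and must meet the number of variables before exceeding it. *)
Definition border_rules : seq (rule pred_name) :=
  let start a h := ([:: un First 0; rd a 0], h) in
  let stop q := ([:: un Last 0; in_phase q 0], un Fail 0) in
  [:: start LQuant (in_phase Quant0 0); start LQuant (bi Vars 0 0);
      start LEdge (un Fail 0); start LSep (un Fail 0); start LTick (un Fail 0);
      stop Quant0; stop Quant1; stop Index1;
      ([:: un Last 0; in_phase Index2 0; bi Index 0 1; bi Ticks 0 2],
         bi Differ 1 2);
      ([:: bi Ticks 0 1; bi Vars 0 1], un Fail 0)].

(** Four rules for the order, then the fields of [closed_facts] in their order, with one rule for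
    each part of a conjunction. The variables 0, 1, 2 stand for x, y, z of those fields, and 3, 4
    for the further ones. *)
Definition game_rules : seq (rule pred_name) :=
  let both := [:: bi Lt 0 1; bi Lt 1 2; bi Lt 3 4; bi Lt 4 2] in
  let top := [:: bi Lt 0 1; bi Lt 1 2; bi Lt 3 1; ter Nad 0 1 2; ter Avoid 3 1 2] in
  [:: ([:: bi Succ 0 1], bi Lt 0 1);
      ([:: bi Lt 0 1; bi Succ 1 2], bi Lt 0 2);
      ([:: bi Lt 0 1], bi Le 0 1);
      ([::], bi Le 0 0);
      ([:: bi Differ 0 1], bi Differ 1 0);
      ([:: ter Nad 0 1 2], ter Nad 1 0 2);
      ([:: ter Nad 0 1 2], ter Nad 1 2 0);
      ([:: ter Avoid 0 1 2], ter Avoid 1 0 2);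
      ([:: bi Differ 0 2; bi Differ 1 2], ter Avoid 0 1 2);
      ([:: bi Differ 0 0], un Fail 0);
      ([:: bi Lt 0 1; ter Avoid 0 1 1], un Fail 0);
      ([:: bi Lt 0 1; bi Lt 2 1; ter Avoid 0 1 2], bi Differ 0 2);
      ([:: bi Lt 0 1; bi Lt 2 1; ter Avoid 0 1 2], bi Differ 1 2);
      ([:: bi Lt 0 1; bi Lt 1 2; bi Lt 3 2; ter Avoid 0 1 2; bi Differ 3 2],
         ter Nad 0 1 3);
      ([:: bi Lt 0 1; bi Lt 1 2; bi Lt 3 2; ter Nad 0 1 2; bi Differ 3 2],
         ter Avoid 0 1 3);
      (both ++ [:: bi Le 1 4; ter Nad 0 1 2; ter Nad 3 4 2], ter Nad 0 1 3);
      (both ++ [:: bi Le 1 4; ter Nad 0 1 2; ter Nad 3 4 2], ter Nad 0 1 4);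
      (both ++ [:: bi Le 1 4; ter Avoid 0 1 2; ter Avoid 3 4 2], ter Nad 0 1 3);
      (both ++ [:: bi Le 1 4; ter Avoid 0 1 2; ter Avoid 3 4 2], ter Nad 0 1 4);
      (both ++ [:: bi Lt 1 4; ter Nad 0 1 2; ter Avoid 3 4 2], ter Avoid 0 1 3);
      (both ++ [:: bi Lt 1 4; ter Nad 0 1 2; ter Avoid 3 4 2], ter Avoid 0 1 4);
      (both ++ [:: bi Lt 1 4; ter Avoid 0 1 2; ter Nad 3 4 2], ter Avoid 0 1 3);
      (both ++ [:: bi Lt 1 4; ter Avoid 0 1 2; ter Nad 3 4 2], ter Avoid 0 1 4);
      (top, bi Differ 0 3);
      (top, ter Nad 0 3 1)].

Definition all_trans_rules : seq (rule pred_name) :=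
  flatten [seq trans_rules qa.1 qa.2 | qa : phase * letter].

Definition csp_rules : seq (rule pred_name) :=
  all_trans_rules ++ border_rules ++ game_rules.

Lemma csp_rules_ok : all (@rule_ok _) csp_rules.
Proof.
rewrite !all_cat; apply/and3P; split=> //.
by apply/allP => r /flatten_imageP[[q a] _]; apply: allP; case: q; case: a.
Qed.

(** For a concrete rule this computes to a curried implication between facts, which can be applied
    like a hypothesis. *)
Definition rule_impl (I : interp pred_name) (vs : seq nat)
    (r : rule pred_name) : Prop :=
  foldr (fun a Q => atom_holds I vs a -> Q) (atom_holds I vs r.2) r.1.

Lemma rule_implP I vs (r : rule pred_name) : rule_impl I vs r <->
  ((forall a, a \in r.1 -> atom_holds I vs a) -> atom_holds I vs r.2).
Proof.
case: r => b h; rewrite /rule_impl /=; elim: b => [|a b IH] /=.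
  by split=> [H _|]; [|apply].
split=> [H hb|H ha].
  have /H/IH : atom_holds I vs a by apply: hb; rewrite inE eqxx.
  by apply=> a' ha'; apply: hb; rewrite inE ha' orbT.
by apply/IH => hb; apply: H => a'; rewrite inE => /orP[/eqP->|/hb].
Qed.

Lemma rule_holdsP n I (r : rule pred_name) :
  rule_holds n I r <-> forall v0 v1 v2 v3 v4, v0 < n -> v1 < n -> v2 < n ->
    v3 < n -> v4 < n -> rule_impl I [:: v0; v1; v2; v3; v4] r.
Proof.
split=> [h v0 v1 v2 v3 v4 h0 h1 h2 h3 h4|h].
  by apply/rule_implP/h => //; apply/and5P; split=> //; apply/andP.
case=> [|v0 [|v1 [|v2 [|v3 [|v4 []]]]]] //= _ /and5P[h0 h1 h2 h3 /andP[h4 _]].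
by apply/rule_implP; apply: h.
Qed.

(** For a concrete list this computes to nested conjunctions, which intro patterns take apart rule
    by rule. *)
Fixpoint conj_all (T : Type) (Q : T -> Prop) (s : seq T) : Prop :=
  if s is x :: s' then Q x /\ conj_all Q s' else True.

Lemma conj_allP (T : eqType) (Q : T -> Prop) (s : seq T) :
  conj_all Q s <-> forall x, x \in s -> Q x.
Proof.
elim: s => [|x s IH] /=; first by split.
split=> [[hx /IH hs] y|h]; first by rewrite inE => /orP[/eqP->|/hs].
split; first by apply: h; rewrite inE eqxx.
by apply/IH => y hy; apply: h; rewrite inE hy orbT.
Qed.

(** * From a model without failure to a true sentence *)

Section Completeness.
Variables (w : seq letter) (I : interp pred_name).
Local Notation n := (size w).

Hypothesis hI : model of_letter (of_symbol Succ) (of_symbol First)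
  (of_symbol Last) csp_rules w I.
Hypothesis no_fail :
  forall x y z, x < n -> y < n -> z < n -> ~ I (of_symbol Fail) x y z.

Let S2 p x y := I (of_symbol p) x y y.
Let S3 p x y z := I (of_symbol p) x y z.

Lemma use_trans q a : conj_all (rule_holds n I) (trans_rules q a).
Proof.
apply/conj_allP => r hr; apply: (model_rule hI); rewrite mem_cat; apply/orP; left.
by apply/flatten_imageP; exists (q, a).
Qed.

Lemma use_border : conj_all (rule_holds n I) border_rules.
Proof.
by apply/conj_allP => r hr; apply: (model_rule hI); rewrite !mem_cat hr orbT.
Qed.

Lemma use_game : conj_all (rule_holds n I) game_rules.
Proof.
by apply/conj_allP => r hr; apply: (model_rule hI); rewrite !mem_cat hr !orbT.
Qed.

Definition recorded (s : pstate) (p : nat) := [/\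
  I (of_phase (ph s)) p p p,
  S2 Vars p (nvars s),
  ph s = Index1 \/ ph s = Index2 -> S2 Ticks p (ticks s) &
  ph s = Index2 -> S2 Index p (index1 s)].

Ltac fire h v0 v1 v2 v3 v4 :=
  let H := fresh in
  have H := (proj1 (rule_holdsP _ _ _) h) v0 v1 v2 v3 v4;
  rewrite /rule_impl /= in H; apply: H => //.

(** Whatever the model, the rules force the facts that describe each state of the scan. A letter
    without a transition, or an index out of range, would force [Fail], so the scan cannot get
    stuck. *)
Lemma scan_recorded k : k <= n -> exists s, [/\ scan_word (take k w) = Some s,
  0 < k -> recorded s k.-1 & forall a, a \in read s -> S2 Differ a.1 a.2].
Proof.
elim: k => [|k IH] kn.
  by exists (PState Between 0 0 0 [::]); rewrite take0.
have [s [es hs hD]] := IH (ltnW kn); have [a wk] := onth_ltn kn.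
have ea : scan_word (take k.+1 w) = pstep s a.
  by rewrite (take_nth a) // scan_word_rcons es (onth_nth _ _ _ _ wk).
rewrite ea {IH}; have la := model_letter hI wk.
have [b1 [b2 [b3 [b4 [b5 [_ [_ [_ [_ [b10 _]]]]]]]]]] := use_border.
case: k => [|p] in kn es hs ea wk la *.
  have n0 := kn; have hf := model_first hI n0.
  have {hs hD es} -> : s = PState Between 0 0 0 [::].
    by move: es; rewrite take0 => -[].
  case: a => [|||] in ea wk la *; last 3 first.
  - by case: (no_fail n0 n0 n0); fire b3 0 0 0 0 0.
  - by case: (no_fail n0 n0 n0); fire b4 0 0 0 0 0.
  - by case: (no_fail n0 n0 n0); fire b5 0 0 0 0 0.
  exists (PState Quant0 0 0 0 [::]); split=> // _; split=> //=; try by case.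
    by fire b1 0 0 0 0 0.
  by fire b2 0 0 0 0 0.
have pn : p < n by apply: ltnW.
have hsc := model_succ hI kn.
have [hq hV hT hX] := hs isT; rewrite [p.+1.-1]/= in hq hV hT hX.
have [_ hc] := scan_word_written es.
have hv : nvars s < p.+1.
  by move: (nvars_lt es); rewrite size_takel ?(ltnW kn) // => /(_ isT).
have vn : nvars s < n by lia.
have v1n : (nvars s).+1 < n by lia.
have n0 : 0 < n by lia.
have hf := model_first hI n0.
(* The only way for [ranged] to reject here is equality of ticks and variables, and that is the
   premise of the last border rule. *)
have over s1 : recorded s1 p.+1 -> ph s1 = Index1 \/ ph s1 = Index2 ->
    ticks s1 <= nvars s1 -> nvars s1 < n -> ranged s1 = Some s1.
  move=> [_ hV1 hT1 _] /hT1 {}hT1 h1 h2; rewrite /ranged.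
  move: h1; rewrite leq_eqVlt => /orP[/eqP e|-> //].
  case: (no_fail kn kn kn); rewrite e in hT1.
  by fire b10 p.+1 (nvars s1) 0 0 0.
have trans := use_trans (ph s) a; rewrite [p.+2.-1]/=.
case: s es hq hV hT hX hc hv vn v1n hD trans {ea hs} => q m i k ats /=.
move=> es hq hV hT hX.
move=> /andP[_ hc] hv vn v1n hD.
have hvs := model_succ hI v1n.
have hks : k < m -> I (of_symbol Succ) k k.+1 k.+1.
  by move=> km; apply: (model_succ hI); apply: leq_ltn_trans vn.
have i1 : Index1 = Index1 \/ Index1 = Index2 by left.
have i2 : Index2 = Index1 \/ Index2 = Index2 by right.
have next s1 : ranged s1 = Some s1 -> recorded s1 p.+1 ->
    (forall a, a \in read s1 -> S2 Differ a.1 a.2) ->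
    exists s, [/\ ranged s1 = Some s, 0 < p.+2 -> recorded s p.+1 &
      forall a, a \in read s -> S2 Differ a.1 a.2].
  by exists s1.
case: q hq hT hX hc {es}; case: a {wk} la => la hq hT hX hc;
  try by [move=> [t _]; case: (no_fail pn pn pn); fire t p p.+1 0 0 0].
- case=> [t1 [t2 _]]; eexists; split=> // _; split=> //=; try by case.
    by fire t1 p p.+1 0 0 0.
  by fire t2 p p.+1 m 0 0.
- case=> [t1 [t2 [t3 _]]].
  have hr : recorded (PState Index1 m i 0 ats) p.+1.
    split=> //= [||_].
    + by fire t1 p p.+1 0 0 0.
    + by fire t2 p p.+1 m 0 0.
    + by fire t3 p p.+1 0 0 0.
  by apply: next => //; apply: over.
- case=> [t1 [t2 _]]; eexists; split=> // _; split=> //=; try by case.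
    by fire t1 p p.+1 0 0 0.
  by fire t2 p p.+1 m 0 0.
- case=> [t1 [t2 _]]; eexists; split=> // _; split=> //=; try by case.
    by fire t1 p p.+1 0 0 0.
  by fire t2 p p.+1 m m.+1 0.
- case=> [t1 [t2 [t3 [t4 _]]]].
  have hr : recorded (PState Index2 m k 0 ats) p.+1.
    split=> //= [||_|_].
    + by fire t1 p p.+1 0 0 0.
    + by fire t2 p p.+1 m 0 0.
    + by fire t3 p p.+1 0 0 0.
    + by fire t4 p p.+1 k 0 0; [apply: ltn_trans vn|apply: hT].
  by apply: next => //; apply: over.
- case=> [t1 [t2 [t3 _]]].
  have hr : recorded (PState Index1 m i k.+1 ats) p.+1.
    split=> //= [||_].
    + by fire t1 p p.+1 0 0 0.
    + by fire t2 p p.+1 m 0 0.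
    + by fire t3 p p.+1 k k.+1 0;
        [apply: ltn_trans vn|apply: leq_ltn_trans vn|apply: hT|apply: hks].
  by apply: next => //; apply: over.
- case/andP: hc => him hkm [t1 [t2 [t3 [t4 _]]]].
  have hr : recorded (PState Index1 m i 0 (rcons ats (i, k))) p.+1.
    split=> //= [||_].
    + by fire t1 p p.+1 0 0 0.
    + by fire t2 p p.+1 m 0 0.
    + by fire t3 p p.+1 0 0 0.
  apply: next => //; first exact: over.
  move=> a /=; rewrite mem_rcons inE => /orP[/eqP->|/hD //] /=.
  fire t4 p p.+1 i k 0;
    [exact: ltn_trans vn|exact: ltn_trans vn|exact: hX|exact: hT].
- case/andP: hc => him hkm [t1 [t2 [t3 [t4 _]]]].
  have hr : recorded (PState Index2 m i k.+1 ats) p.+1.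
    split=> //= [||_|_].
    + by fire t1 p p.+1 0 0 0.
    + by fire t2 p p.+1 m 0 0.
    + by fire t3 p p.+1 k k.+1 0;
        [apply: ltn_trans vn|apply: leq_ltn_trans vn|apply: hT|apply: hks].
    + by fire t4 p p.+1 i 0 0; [apply: ltn_trans vn|apply: hX].
  by apply: next => //; apply: over.
Qed.

Lemma scan_accepts : exists s, [/\ scan_word w = Some s, complete s &
  forall a, a \in all_read s -> S2 Differ a.1 a.2].
Proof.
have [s [es hs hD]] := scan_recorded (leqnn n); rewrite take_size in es.
have [_ hc] := scan_word_written es.
have hv := nvars_lt es.
(* The empty word has no last position for the border rules to inspect; it encodes the sentence
   without variables and is accepted. *)
exists s; case: (posnP n) => [/size0nil w0|n0].
  by move: es hD; rewrite w0 => -[<-].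
have hl := model_last hI (prednK n0).
have pn : n.-1 < n by rewrite prednK.
have [_ [_ [_ [_ [_ [b6 [b7 [b8 [b9 _]]]]]]]]] := use_border.
have [hq _ hT hX] := hs n0; have {}hv := hv n0.
case: s es hq hT hX hD hc hv {hs} => -[] m i k ats /= es hq hT hX hD /andP[_ hc] hv;
  try by [case: (no_fail pn pn pn); fire b6 n.-1 0 0 0 0
         |case: (no_fail pn pn pn); fire b7 n.-1 0 0 0 0
         |case: (no_fail pn pn pn); fire b8 n.-1 0 0 0 0].
  by split.
split=> // a; rewrite /all_read /= mem_rcons inE => /orP[/eqP->|/hD //] /=.
case/andP: hc => hi hk.
fire b9 n.-1 i k 0 0; [exact: ltn_trans hv|exact: ltn_trans hv|exact: hX|].
by apply: hT; right.
Qed.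

Lemma lt_facts x y : x < y -> y < n -> S2 Lt x y.
Proof.
have [g1 [g2 _]] := use_game.
elim: y => // y IH; rewrite ltnS leq_eqVlt => /orP[/eqP->|xy] yn.
  have hs := model_succ hI yn.
  by fire g1 y y.+1 0 0 0; [apply: ltnW|apply: leq_ltn_trans yn..].
have hs := model_succ hI yn; have h := IH xy (ltnW yn).
fire g2 x y y.+1 0 0; [|exact: ltnW|apply: leq_ltn_trans yn..] => //.
by apply: ltn_trans (ltnW yn).
Qed.

Lemma le_facts x y : x <= y -> y < n -> S2 Le x y.
Proof.
have [_ [_ [g3 [g4 _]]]] := use_game.
rewrite leq_eqVlt => /orP[/eqP->|xy] yn; first by fire g4 y y y y y.
by fire g3 x y y y y; [apply: ltn_trans yn|apply: lt_facts].
Qed.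

Lemma model_closed_facts m :
  m <= n -> closed_facts m (S2 Differ) (S3 Nad) (S3 Avoid).
Proof.
move=> mn.
have [_ [_ [_ [_ [g5 [g6 [g7 [g8 [g9 [g10 [g11 [g12 [g13 [g14 [g15 [g16 [g17
  [g18 [g19 [g20 [g21 [g22 [g23 [g24 [g25 _]]]]]]]]]]]]]]]]]]]]]]]]] := use_game.
have lt x y : x < y -> y < m -> S2 Lt x y.
  by move=> xy ym; apply: lt_facts => //; apply: leq_trans mn.
have le x y : x <= y -> y < m -> S2 Le x y.
  by move=> xy ym; apply: le_facts => //; apply: leq_trans mn.
have mS v : v < m -> v < n by move=> vm; apply: leq_trans mn.
have fail x : x < m -> ~ I (of_symbol Fail) x x x.
  by move=> /mS xn; apply: no_fail.
split.
- by move=> x y /mS xn /mS yn h; fire g5 x y x x x.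
- by move=> x y z /mS xn /mS yn /mS zn h; fire g6 x y z x x.
- by move=> x y z /mS xn /mS yn /mS zn h; fire g7 x y z x x.
- by move=> x y z /mS xn /mS yn /mS zn h; fire g8 x y z x x.
- by move=> x y z /mS xn /mS yn /mS zn h h'; fire g9 x y z x x.
- by move=> x xm h; apply: (fail x xm); move/mS: xm => xn; fire g10 x x x x x.
- move=> x y xy ym h; have xm : x < m by lia.
  by apply: (fail x xm); fire g11 x y x x x; first [exact: lt|exact: mS].
- move=> x y w' xy wy ym h; have [xm wm] : x < m /\ w' < m by lia.
  by split; [fire g12 x y w' x x|fire g13 x y w' x x];
    first [exact: lt|exact: mS].
- move=> x y z v /andP[xy yz] vz zm h h'.
  have [xm ym vm] : [/\ x < m, y < m & v < m] by split; lia.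
  by fire g14 x y z v x; first [exact: lt|exact: mS].
- move=> x y z v /andP[xy yz] vz zm h h'.
  have [xm ym vm] : [/\ x < m, y < m & v < m] by split; lia.
  by fire g15 x y z v x; first [exact: lt|exact: mS].
- move=> x y x' y' z /andP[xy yz] /andP[xy' yz'] yy zm h h'.
  have [xm ym xm' ym'] : [/\ x < m, y < m, x' < m & y' < m] by split; lia.
  by split; [fire g16 x y z x' y'|fire g17 x y z x' y'];
    first [exact: lt|exact: le|exact: mS].
- move=> x y x' y' z /andP[xy yz] /andP[xy' yz'] yy zm h h'.
  have [xm ym xm' ym'] : [/\ x < m, y < m, x' < m & y' < m] by split; lia.
  by split; [fire g18 x y z x' y'|fire g19 x y z x' y'];
    first [exact: lt|exact: le|exact: mS].
- move=> x y x' y' z /andP[xy yz] /andP[xy' yz'] yy zm h h'.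
  have [xm ym xm' ym'] : [/\ x < m, y < m, x' < m & y' < m] by split; lia.
  by split; [fire g20 x y z x' y'|fire g21 x y z x' y'];
    first [exact: lt|exact: mS].
- move=> x y x' y' z /andP[xy yz] /andP[xy' yz'] yy zm h h'.
  have [xm ym xm' ym'] : [/\ x < m, y < m, x' < m & y' < m] by split; lia.
  by split; [fire g22 x y z x' y'|fire g23 x y z x' y'];
    first [exact: lt|exact: mS].
- move=> x x' y z /andP[xy yz] xy' zm h h'.
  have [xm ym xm'] : [/\ x < m, y < m & x' < m] by split; lia.
  by split; [fire g24 x y z x' x|fire g25 x y z x' x];
    first [exact: lt|exact: mS].
Qed.

Lemma model_X_CSP : X_CSP (pred1 2) (K 4) w.
Proof.
have [s [es hc hD]] := scan_accepts.
have [ew hX] := scan_word_decodes es hc.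
have hm : nvars s <= n.
  case: (posnP n) => [/size0nil w0|/(nvars_lt es)/ltnW //].
  by move: es; rewrite w0 => -[<-].
exists (Sentence (nseq (nvars s) 2) (all_read s)); split=> //.
have hR : in_range (nvars s) (all_read s).
  by move: hX => /andP[_]; rewrite /= size_nseq.
have := closed_facts_wins (model_closed_facts hm) (ats := all_read s).
rewrite /wins subn0; apply=> a ha.
by have /andP[] := allP hR _ ha; split=> //; apply: hD.
Qed.

End Completeness.

(** * From a true sentence to a model without failure *)

Section Soundness.
Variable phi : sentence.
Hypothesis hX : X_sentence (pred1 2) phi.
Hypothesis hphi : sentence_true (K 4) phi.
Local Notation w := (encode phi).
Local Notation n := (size w).
Local Notation m := (size (quants phi)).

Definition state_at (x : nat) (Q : pstate -> Prop) : Prop :=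
  exists2 s, scan_word (take x.+1 w) = Some s & Q s.

(** [Ticks] is confined to the index phases because elsewhere the counter is stale: after the first
    [LQuant] both ticks and variables are 0, and the last border rule would yield [Fail]. *)
Definition intended : interp pred_name := fun p x y z =>
  match p with
  | inl a => onth w x = Some a
  | inr (inl q) => state_at x (fun s => ph s = q)
  | inr (inr p) =>
      match p with
      | Succ => y = x.+1
      | First => x = 0
      | Last => x.+1 = n
      | Fail => False
      | Vars => state_at x (fun s => nvars s = y)
      | Ticks => state_at x
          (fun s => (ph s = Index1 \/ ph s = Index2) /\ ticks s = y)
      | Index => state_at x (fun s => ph s = Index2 /\ index1 s = y)
      | Lt => x < y
      | Le => x <= y
      | Differ => dsure m (atoms phi) x y
      | Nad => nsure m (atoms phi) x y z
      | Avoid => msure m (atoms phi) x y z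
      end
  end.

Lemma wins_start : wins m (atoms phi) [::].
Proof.
have [s [_ _ e _]] := scan_word_encode hX.
by move: hphi; rewrite /sentence_true /wins subn0 e size_nseq.
Qed.

Lemma intended_game : conj_all (rule_holds n intended) game_rules.
Proof.
have hw := wins_start.
have lt3 x y z : x < y -> y < z -> x < y < z by move=> -> ->.
rewrite /=; repeat match goal with |- rule_holds _ _ _ /\ _ => split end => //;
  apply/rule_holdsP => x y z x' y' hx hy hz hx' hy'; rewrite /rule_impl /=.
- by move=> ->.
- by move=> h ->; apply: ltnW.
- exact: ltnW.
- exact: leqnn.
- exact: dsure_sym.
- exact: nsure_swap.
- exact: nsure_rot.
- exact: msure_swap.
- exact: dsure_dsure.
- exact: dsure_irrefl.
- exact: msure_irrefl.
- by move=> xy yz /(msure_low xy yz)[].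
- by move=> xy yz /(msure_low xy yz)[].
- by move=> xy yz wz; apply: msure_dsure_nsure => //; apply: lt3.
- by move=> xy yz wz; apply: nsure_dsure_msure => //; apply: lt3.
- move=> xy yz xy' yz' yy h h'.
  by have [] := same_pair_nsure xy xy' yy
    (nsure_same_pair (lt3 _ _ _ xy yz) (lt3 _ _ _ xy' yz') h h').
- move=> xy yz xy' yz' yy h h'.
  by have [] := same_pair_nsure xy xy' yy
    (nsure_same_pair (lt3 _ _ _ xy yz) (lt3 _ _ _ xy' yz') h h').
- move=> xy yz xy' yz' yy h h'.
  by have [] := same_pair_nsure xy xy' yy
    (msure_same_pair (lt3 _ _ _ xy yz) (lt3 _ _ _ xy' yz') h h').
- move=> xy yz xy' yz' yy h h'.
  by have [] := same_pair_nsure xy xy' yy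
    (msure_same_pair (lt3 _ _ _ xy yz) (lt3 _ _ _ xy' yz') h h').
- move=> xy yz xy' yz' yy h h'.
  by have [] := disjoint_pair_msure xy xy' yy
    (nsure_msure_disjoint (lt3 _ _ _ xy yz) (lt3 _ _ _ xy' yz') h h').
- move=> xy yz xy' yz' yy h h'.
  by have [] := disjoint_pair_msure xy xy' yy
    (nsure_msure_disjoint (lt3 _ _ _ xy yz) (lt3 _ _ _ xy' yz') h h').
- move=> xy yz xy' yz' yy h h'.
  by have [] := disjoint_pair_msure xy xy' yy (disjoint_pair_sym
    (nsure_msure_disjoint (lt3 _ _ _ xy' yz') (lt3 _ _ _ xy yz) h' h)).
- move=> xy yz xy' yz' yy h h'.
  by have [] := disjoint_pair_msure xy xy' yy (disjoint_pair_sym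
    (nsure_msure_disjoint (lt3 _ _ _ xy' yz') (lt3 _ _ _ xy yz) h' h)).
- move=> xy yz xy' h h'.
  by have [] := disjoint_pair_same_top xy xy'
    (nsure_msure_disjoint (lt3 _ _ _ xy yz) (lt3 _ _ _ xy' yz) h h').
- move=> xy yz xy' h h'.
  by have [] := disjoint_pair_same_top xy xy'
    (nsure_msure_disjoint (lt3 _ _ _ xy yz) (lt3 _ _ _ xy' yz) h h').
Qed.

Lemma atoms_range : in_range m (atoms phi).
Proof. by move: hX => /andP[_]. Qed.

(** The whole encoding is scanned successfully and failure is absorbing, so no prefix gets stuck;
    atoms once read are never lost, so they are atoms of the sentence. *)
Lemma scan_prefix k s : scan_word (take k w) = Some s ->
  {subset read s <= atoms phi} /\
  forall a, onth w k = Some a ->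
    exists2 s', pstep s a = Some s' & scan_word (take k.+1 w) = Some s'.
Proof.
move=> hs; have [sF [eF _ _ rF]] := scan_word_encode hX.
have split_at j : scan_from (scan_word (take j w)) (drop j w) = Some sF.
  by rewrite /scan_word -scan_from_cat cat_take_drop.
split.
  have := split_at k; rewrite hs => /scan_from_read h x /h.
  by rewrite -rF /all_read; case: (ph sF); rewrite // mem_rcons inE orbC => ->.
move=> a wk; have kn : k < n by rewrite -onthTE wk.
have e : scan_word (take k.+1 w) = pstep s a.
  by rewrite (take_nth a) // scan_word_rcons hs (onth_nth _ _ _ _ wk).
have := split_at k.+1; rewrite e; case: (pstep s a) => [s'|]; last first.
  by rewrite scan_from_None.
by exists s'.
Qed.

Ltac states := repeat match goal with
  | h : state_at _ _ |- _ => destruct h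
  | h : _ /\ _ |- _ => destruct h
  | h1 : scan_word ?u = Some ?s1, h2 : scan_word ?u = Some ?s2 |- _ =>
    assert (s1 = s2) by congruence; subst s2; clear h2
  end.

Lemma intended_trans q a : conj_all (rule_holds n intended) (trans_rules q a).
Proof.
have fin (x y : nat) (Q : pstate -> Prop) b s : scan_word (take x.+1 w) = Some s ->
    y = x.+1 -> onth w y = Some b -> (forall s', pstep s b = Some s' -> Q s') ->
    state_at y Q.
  move=> hs -> hb hQ; have [_ /(_ _ hb)[s' e e']] := scan_prefix hs.
  by exists s' => //; apply: hQ.
case: q; case: a; rewrite /=;
  repeat match goal with |- rule_holds _ _ _ /\ _ => split end => //;
  apply/rule_holdsP => x y z x' y' hx hy hz hx' hy'; rewrite /rule_impl /=;
  intros; states.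
all: try (match goal with
  | hs : scan_word (take _.+1 w) = Some ?s, hb : onth w ?y = Some ?b |- False =>
    subst y; have [_ /(_ _ hb)[s' e' _]] := scan_prefix hs;
    destruct s; simpl in *; subst; discriminate
  end).
all: try (match goal with
  | hs : scan_word (take _.+1 w) = Some ?s, hb : onth w ?y = Some ?b
    |- state_at ?y _ =>
    apply: (fin _ y _ _ _ hs _ hb) => // s'; destruct s; simpl in *; subst;
    first [case=> <- | move=> /ranged_Some[-> _]]; simpl; auto
  end).
(* What remains is the rule that emits [Differ] when [LEdge] completes the pending atom, which the
   next state has moved to [read]. *)
subst y; have [_ /(_ _ H3)[s' e' hs']] := scan_prefix H.
have [hsub _] := scan_prefix hs'.
apply: (atoms_dsure (a := (z, x'))) atoms_range _; apply: hsub.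
destruct x2; simpl in *; subst; move: e' => /ranged_Some[-> _] /=.
by rewrite mem_rcons inE eqxx.
Qed.

Lemma intended_border : conj_all (rule_holds n intended) border_rules.
Proof.
have [sF [eF cF nF rF]] := scan_word_encode hX.
have last x s : x.+1 = n -> scan_word (take x.+1 w) = Some s -> s = sF.
  by move=> ->; rewrite take_size eF => -[].
have first a : onth w 0 = Some a ->
    exists2 s, pstep (PState Between 0 0 0 [::]) a = Some s &
      scan_word (take 1 w) = Some s.
  by move=> wa; have [|_ h] := @scan_prefix 0 (PState Between 0 0 0 [::]);
    [rewrite take0|apply: h].
rewrite /=; repeat match goal with |- rule_holds _ _ _ /\ _ => split end => //;
  apply/rule_holdsP => x y z x' y' hx hy hz hx' hy'; rewrite /rule_impl /=.
- by move=> -> /first[s [<-] hs]; exists (PState Quant0 0 0 0 [::]).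
- by move=> -> /first[s [<-] hs]; exists (PState Quant0 0 0 0 [::]).
- by move=> -> /first[].
- by move=> -> /first[].
- by move=> -> /first[].
- by move=> hl [s /(last _ _ hl)-> hq]; move: cF; rewrite /complete hq.
- by move=> hl [s /(last _ _ hl)-> hq]; move: cF; rewrite /complete hq.
- by move=> hl [s /(last _ _ hl)-> hq]; move: cF; rewrite /complete hq.
- move=> hl [s /(last _ _ hl)-> hq] [s1 /(last _ _ hl)-> [_ h1]].
  move=> [s2 /(last _ _ hl)-> [_ h2]].
  apply: (atoms_dsure (a := (y, z))) atoms_range _.
  by rewrite -rF /all_read hq -h1 -h2 mem_rcons inE eqxx.
- move=> [s hs [hq <-]] [s' hs'] e; have ss : s' = s by congruence.
  rewrite {}ss in e; have [_] := scan_word_written hs.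
  by case: s hq e {hs} => q ? ? ? ? /= [] -> <-; rewrite ltnn ?andbF.
Qed.

Lemma intended_model : model of_letter (of_symbol Succ) (of_symbol First)
  (of_symbol Last) csp_rules w intended.
Proof.
split=> // r; rewrite !mem_cat => /or3P[/flatten_imageP[[q a] _]|hr|hr].
- by move: r; apply/conj_allP/intended_trans.
- by move: r hr; apply/conj_allP/intended_border.
- by move: r hr; apply/conj_allP/intended_game.
Qed.

End Soundness.

(** The two directions use different models: acceptance provides some model without [Fail] facts,
    from which the sentence is decoded, and a true sentence provides [intended]. *)
Theorem theorem9 : polytime_decidable (X_CSP (pred1 2) (K 4)).
Proof.
have [M [c [k hM]]] := datalog_polytime of_letter (of_symbol Succ) (of_symbol First)
  (of_symbol Last) (of_symbol Fail) csp_rules_ok.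
exists M, c, k => w; have [b [hb hw]] := hM w; exists b; split=> //.
split=> [/hw[I [hI hF]]|[phi [hX e ht]]]; first exact: model_X_CSP hI hF.
apply/hw; exists (intended phi); rewrite e; split; first exact: intended_model.
by move=> x y z _ _ _ [].
Qed.
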